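(* Suppose that $M$ and $N$ are $3$-connected matroids such that $|E(N)| \geq 4$, and $C^{*}$ is a cocircuit of $M$ with the property that $M / x_{0}$ has an $N$-minor for some $x_{0} \in C^{*}$. Then at least one of the following holds: (i) there is an element $x \in C^{*}$ such that $\operatorname{si}(M / x)$ is $3$-connected and has an $N$-minor; (ii) there is an element $x \in C^{*}$ such that $\operatorname{co}(\operatorname{si}(M / x))$ is $3$-connected and has an $N$-minor; or (iii) there is a sequence of elements $(x_{1}, x_{2}, x_{3}, x_{4})$ from $E(M)$ such that $\{x_{1}, x_{2}, x_{3}\}$ is a circuit of $M$, $\{x_{2}, x_{3}, x_{4}\}$ is a cocircuit of $M$, $x_{1}, x_{3} \in C^{*}$, and $\operatorname{si}(M / x_{2})$ is $3$-connected with an $N$-minor.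
   Context: All matroids are finite. For a matroid $M$ with ground set $E$ and rank function $r$, the connectivity function is $\lambda_M(X) = r(X) + r(E - X) - r(M)$ for $X \subseteq E$. A $k$-separation of $M$ is a partition $(X, E-X)$ of $E$ with $\lambda_M(X) < k$ and $|X|, |E-X| \geq k$. $M$ is $n$-connected if it has no $k$-separation for any $k < n$ ($k$ a positive integer). $\operatorname{si}(M)$ is the simple matroid associated with $M$ (delete all loops and all but one element of each parallel class), and $\operatorname{co}(M) = (\operatorname{si}(M^* ))^*$ is the cosimple matroid associated with $M$. A matroid has an $N$-minor if it has a minor isomorphic to $N$. *)

(* Defs.v *)
From mathcomp Require Import all_boot.
From mathcomp Require Import zify.

Set Implicit Arguments.
Unset Strict Implicit.
Unset Printing Implicit Defensive.

(* A matroid whose elements live in an ambient finite type T.  Its ground set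
   is a subset of T, so that minors of M are again matroids over T.  The value
   of [rank] outside the subsets of [ground] is irrelevant. *)
Record matroid (T : finType) := Matroid {
  ground : {set T};
  rank : {set T} -> nat;
  rank_le_card : forall X : {set T}, X \subset ground -> rank X <= #|X|;
  rank_mono : forall X Y : {set T}, X \subset Y -> Y \subset ground -> rank X <= rank Y;
  rank_submod : forall X Y : {set T}, X \subset ground -> Y \subset ground ->
    rank (X :|: Y) + rank (X :&: Y) <= rank X + rank Y
}.

Section Deletion.
Variables (T : finType) (M : matroid T) (D : {set T}).

Let sub (X : {set T}) : X \subset ground M :\: D -> X \subset ground M.
Proof. by rewrite subsetD => /andP[]. Qed.

Fact delete_le_card (X : {set T}) : X \subset ground M :\: D -> rank M X <= #|X|.
Proof. by move=> /sub; exact: rank_le_card. Qed.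

Fact delete_mono (X Y : {set T}) :
  X \subset Y -> Y \subset ground M :\: D -> rank M X <= rank M Y.
Proof. by move=> sXY /sub; exact: rank_mono. Qed.

Fact delete_submod (X Y : {set T}) :
    X \subset ground M :\: D -> Y \subset ground M :\: D ->
  rank M (X :|: Y) + rank M (X :&: Y) <= rank M X + rank M Y.
Proof. by move=> /sub sX /sub sY; exact: rank_submod. Qed.

Definition delete : matroid T :=
  Matroid delete_le_card delete_mono delete_submod.
End Deletion.

Section Contraction.
Variables (T : finType) (M : matroid T) (C : {set T}).

(* For C a subset of the ground set this is X |-> r(X :|: C) - r(C). *)
Definition contract_rank (X : {set T}) : nat :=
  rank M (X :|: (C :&: ground M)) - rank M (C :&: ground M).

Let sC : C :&: ground M \subset ground M. Proof. exact: subsetIr. Qed.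

Let sub (X : {set T}) : X \subset ground M :\: C -> X \subset ground M.
Proof. by rewrite subsetD => /andP[]. Qed.

Let subU (X : {set T}) : X \subset ground M :\: C -> X :|: (C :&: ground M) \subset ground M.
Proof. by move=> /sub sX; rewrite subUset sX sC. Qed.

Fact contract_le_card (X : {set T}) : X \subset ground M :\: C -> contract_rank X <= #|X|.
Proof.
move=> /sub sX; rewrite /contract_rank.
have := rank_submod sX sC; have := rank_le_card sX; lia.
Qed.

Fact contract_mono (X Y : {set T}) :
  X \subset Y -> Y \subset ground M :\: C -> contract_rank X <= contract_rank Y.
Proof.
move=> sXY sY; apply: leq_sub2r; apply: rank_mono (subU sY).
exact: setSU.
Qed.

Fact contract_submod (X Y : {set T}) :
    X \subset ground M :\: C -> Y \subset ground M :\: C ->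
  contract_rank (X :|: Y) + contract_rank (X :&: Y)
    <= contract_rank X + contract_rank Y.
Proof.
move=> sX sY; rewrite /contract_rank.
have := rank_submod (subU sX) (subU sY).
rewrite -setUUl -setUIl.
have ge (Z : {set T}) : Z \subset ground M :\: C ->
    rank M (C :&: ground M) <= rank M (Z :|: (C :&: ground M)).
  by move=> sZ; apply: rank_mono (subU sZ); exact: subsetUr.
have := ge _ sX; have := ge _ sY.
have sXYI : X :&: Y \subset ground M :\: C by rewrite subIset ?sX.
have sXYU : X :|: Y \subset ground M :\: C by rewrite subUset sX.
have := ge _ sXYI; have := ge _ sXYU; lia.
Qed.

Definition contract : matroid T :=
  Matroid contract_le_card contract_mono contract_submod.
End Contraction.

Section Dual.
Variables (T : finType) (M : matroid T).
Notation E := (ground M).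

Definition dual_rank (X : {set T}) : nat := #|X| + rank M (E :\: X) - rank M E.

Let le_E (X : {set T}) : X \subset E -> rank M E <= #|X| + rank M (E :\: X).
Proof.
move=> sX; have := rank_submod sX (subsetDl E X).
have -> : X :|: (E :\: X) = E by rewrite setUC -{2}(setIidPr sX) setUC setID.
have := rank_le_card sX; lia.
Qed.

Fact dual_le_card (X : {set T}) : X \subset E -> dual_rank X <= #|X|.
Proof.
move=> sX; rewrite /dual_rank.
have := rank_mono (subsetDl E X) (subxx E); lia.
Qed.

Fact dual_mono (X Y : {set T}) : X \subset Y -> Y \subset E -> dual_rank X <= dual_rank Y.
Proof.
move=> sXY sY; rewrite /dual_rank; apply: leq_sub2r.
have sD : Y :\: X \subset E by apply: subset_trans sY; exact: subsetDl.
have := rank_submod sD (subsetDl E Y).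
have -> : (Y :\: X) :|: (E :\: Y) = E :\: X.
  apply/setP => z; rewrite !inE.
  have := subsetP sXY z; have := subsetP sY z.
  case: (z \in X); case: (z \in Y); case: (z \in E) => //= a b;
    by [have := a isT | have := b isT].
have := rank_le_card sD; have := subset_leq_card sXY.
rewrite cardsD (setIidPr sXY); lia.
Qed.

Fact dual_submod (X Y : {set T}) : X \subset E -> Y \subset E ->
  dual_rank (X :|: Y) + dual_rank (X :&: Y) <= dual_rank X + dual_rank Y.
Proof.
move=> sX sY; rewrite /dual_rank.
have := rank_submod (subsetDl E X) (subsetDl E Y).
rewrite -setDIr -setDUr.
have sU : X :|: Y \subset E by rewrite subUset sX.
have sI : X :&: Y \subset E by rewrite subIset ?sX.
have := le_E sU; have := le_E sI; have := le_E sX; have := le_E sY.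
have := cardsUI X Y; lia.
Qed.

Definition dual : matroid T := Matroid dual_le_card dual_mono dual_submod.
End Dual.

Section Notions.
Variable T : finType.
Implicit Types (M : matroid T) (X C : {set T}) (x y : T) (k n : nat).

Definition dependent M : pred {set T} :=
  [pred X : {set T} | (X \subset ground M) && (rank M X < #|X|)].

Definition circuit M C : bool := minset (dependent M) C.

Definition cocircuit M C : bool := circuit (dual M) C.

(* The natural subtraction is exact for X \subset ground M, by submodularity. *)
Definition connectivity M X : nat :=
  rank M X + rank M (ground M :\: X) - rank M (ground M).

Definition separation M k X : bool :=
  [&& X \subset ground M, connectivity M X < k,
      k <= #|X| & k <= #|ground M :\: X|].

Definition connected n M : Prop :=
  forall k, 0 < k < n -> ~ exists X, separation M k X.

Definition loop M x : bool := (x \in ground M) && (rank M [set x] == 0).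

Definition nonloops M : {set T} := [set x in ground M | ~~ loop M x].

(* On nonloops: x and y are equal or {x, y} is a circuit. *)
Definition parallel M x y : bool := rank M [set x; y] == 1.

Definition parallel_classes M : {set {set T}} :=
  equivalence_partition (parallel M) (nonloops M).

Definition si M : matroid T :=
  delete M (ground M :\: transversal (parallel_classes M) (nonloops M)).

Definition co M : matroid T := dual (si (dual M)).

Lemma nonloopsP M x : x \in nonloops M ->
  [set x] \subset ground M /\ rank M [set x] = 1.
Proof.
rewrite inE /loop => /andP[xE]; rewrite xE /= => nl.
have sx : [set x] \subset ground M by rewrite sub1set.
by split=> //; have := rank_le_card sx; rewrite cards1; lia.
Qed.

Lemma parallel_equiv M :
  {in nonloops M & &, equivalence_rel (parallel M)}.
Proof.
have tr x y z : x \in nonloops M -> y \in nonloops M -> z \in nonloops M ->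
    parallel M x y -> parallel M y z -> parallel M x z.
  move=> /nonloopsP[sx rx] /nonloopsP[sy ry] /nonloopsP[sz rz] /eqP pxy /eqP pyz.
  have sub2 (a b : T) : [set a] \subset ground M -> [set b] \subset ground M ->
      [set a; b] \subset ground M by move=> sa sb; rewrite subUset sa.
  have := rank_submod (sub2 _ _ sx sy) (sub2 _ _ sy sz).
  have sI : [set y] \subset [set x; y] :&: [set y; z].
    by rewrite sub1set !inE eqxx orbT.
  have := rank_mono sI (subset_trans (subsetIl _ _) (sub2 _ _ sx sy)).
  have sXZ : [set x; z] \subset [set x; y] :|: [set y; z].
    by apply/subsetP => w; rewrite !inE; case/orP => ->; rewrite ?orbT.
  have sA : [set x; y] :|: [set y; z] \subset ground M.
    by rewrite subUset !sub2.
  have := rank_mono sXZ sA.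
  have := rank_mono (subsetUl [set x] [set z]) (sub2 _ _ sx sz).
  by rewrite /parallel pxy pyz ry rx; lia.
have sym x y : parallel M x y = parallel M y x by rewrite /parallel setUC.
move=> x y z xN yN zN; split.
  by have [_ rz] := nonloopsP zN; rewrite /parallel setUid rz.
move=> pxy; apply/idP/idP; last exact: tr pxy.
by apply: tr => //; rewrite sym.
Qed.

Lemma parallel_classes_partition M :
  partition (parallel_classes M) (nonloops M).
Proof. by apply: equivalence_partitionP; exact: parallel_equiv. Qed.

End Notions.

(* Bijections are taken between the ground sets themselves, as subtypes. *)
Definition isomorphic (T T' : finType) (M : matroid T) (N : matroid T') : Prop :=
  exists f : {x : T | x \in ground M} -> {y : T' | y \in ground N},
    bijective f /\
    forall X : {set {x : T | x \in ground M}},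
      rank N [set val (f x) | x in X] = rank M [set val x | x in X].

Definition has_minor (T T' : finType) (M : matroid T) (N : matroid T') : Prop :=
  exists C D : {set T},
    [/\ C \subset ground M, D \subset ground M, [disjoint C & D]
      & isomorphic (delete (contract M C) D) N].

(* Main.v *)
(* Choose x in C* and a partition (X, x, Y) of E(M) into two 3-separating sets
   of rank at least 3 that both span x, such that M / x has an N-minor with at
   most one element in X, and with |X| minimal.  Then X avoids cl(Y) and
   meets C*, and every element of X can be contracted keeping an N-minor.  If
   s is in X and C* and si(M / s) is not 3-connected, uncrossing (X, x, Y) with
   a partition for s either contradicts minimality or covers X + x by two lines
   through s, one of them containing x.  Applying this to two choices of s shows
   that X + x is a line L through x and s together with a single point b.
   For c in L - {x, s}, delete L - {x, s, c}; the result is 3-connected with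
   triangle {x, s, c} and triad {s, c, b}.  By Bixby's lemma either si(M / c) is
   3-connected, giving (i) or (iii), or every 2-separation created by deleting
   c has a side with two elements.  As {s, b} is such a side, co(si(M / s)) is
   then 3-connected, which gives (ii). *)

(* The bound |E(N)| >= 4 decides which side is small: the connectivity of N is at most that of M /
   x, so N has at most one element on one side, and then more than one on the other. Contracting
   another element s yields a different minor, which shares with the old one only the bound on X.
   The minimal choice therefore ranges over the minor as well as over x and X. Conclusion (iii) is
   needed only when X has three elements. A line through a point of C* has at most one point off C*,
   so if L has two points besides x and s, then c can be taken in C*; otherwise X = {c, s, b} is
   itself the triad of (iii). Deleting L - {x, s, c} makes {s, c, b} a triad, so s and b are in
   series once c is deleted too, and contracting s is then a step of cosimplification. In M / s all
   of L - s is one parallel class containing x, so none of these deletions affects si(M / s). This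
   is how a statement about deleting c becomes one about co(si(M / s)). *)
Require Import Defs.
From mathcomp Require Import all_boot.
From mathcomp Require Import zify.

Set Implicit Arguments.
Unset Strict Implicit.
Unset Printing Implicit Defensive.

(* Proves set equalities and inclusions elementwise, from the inclusions and the
   memberships in the context. *)
Ltac setb_at z :=
  repeat match goal with
  | H : is_true (_ \subset _) |- _ =>
    have := H; clear H; move/subsetP/(_ z)/implyP; rewrite ?inE
  end;
  rewrite ?inE;
  repeat match goal with |- context [z == ?x] => case: (z =P x) => [?|_];
    [subst z|] end;
  rewrite ?eqxx /=;
  repeat match goal with
  | H : is_true (?x \in ?A) |- context [?x \in _] => have := H; clear H; rewrite ?inE
  | H : is_true (?x \in ?A) |- context [?x == _] => have := H; clear H; rewrite ?inE
  | H : is_true (?x \in ?A) |- context [_ == ?x] => have := H; clear H; rewrite ?inE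
  | H : is_true (~~ (?x \in ?A)) |- context [?x \in _] => have := H; clear H;
    rewrite ?inE
  | H : is_true (~~ (?x \in ?A)) |- context [?x == _] => have := H; clear H;
    rewrite ?inE
  | H : is_true (~~ (?x \in ?A)) |- context [_ == ?x] => have := H; clear H;
    rewrite ?inE
  | H : is_true (?x != ?y) |- context [?x == ?y] => have := H; clear H
  | H : is_true (?x != ?y) |- context [?y == ?x] => have := H; clear H
  end;
  repeat match goal with |- context [?x == ?y] =>
    let h := fresh in case: (x =P y) => [h|_];
    [first [subst x | subst y | rewrite h]; rewrite ?eqxx|] end;
  rewrite /=;
  repeat match goal with |- context [?x \in ?A] => case: (x \in A) => //= end;
  try by [].

Ltac setb :=
  let z := fresh "z" in
  match goal with
  | |- is_true (_ \subset _) => apply/subsetP => z; setb_at z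
  | |- _ => apply/setP => z; setb_at z
  end.

(* [zify] turns every boolean hypothesis into an arithmetic one, which makes
   [lia] very slow in contexts about sets. *)
Ltac rlia :=
  repeat match goal with
  | H : is_true ?b |- _ =>
    lazymatch b with
    | leq _ _ => fail | negb (leq _ _) => fail | andb _ _ => fail | _ => clear H
    end
  | H : @eq {set _} _ _ |- _ => clear H
  | H : forall _, _ |- _ => clear H
  end; lia.

(** * Rank of arbitrary sets, and closure expressed by rank *)

Section Rank.
Variables (T : finType) (M : matroid T).
Implicit Types (X Y Z : {set T}) (x y e : T).
Notation E := (ground M).

(* Ignoring the elements outside the ground set makes monotonicity and
   submodularity free of side conditions. *)
Definition rk X := rank M (X :&: E).

Lemma rk_rank X : X \subset E -> rk X = rank M X.
Proof. by move=> sX; rewrite /rk (setIidPl sX). Qed.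

Lemma rkS X Y : X \subset Y -> rk X <= rk Y.
Proof. by move=> sXY; apply: rank_mono; rewrite ?subsetIr ?setSI. Qed.

Lemma rk_submod X Y : rk (X :|: Y) + rk (X :&: Y) <= rk X + rk Y.
Proof. by rewrite /rk setIUl setIIl rank_submod ?subsetIr. Qed.

Lemma rk_card X : rk X <= #|X|.
Proof.
by rewrite (leq_trans (rank_le_card (subsetIr _ _))) ?subset_leq_card ?subsetIl.
Qed.

Lemma rk_uncross (A B X Y : {set T}) :
  A \subset X :|: Y -> B \subset X :&: Y -> rk A + rk B <= rk X + rk Y.
Proof.
by move=> /rkS sA /rkS sB; have := rk_submod X Y; lia.
Qed.

Lemma rkU1 x X : rk (x |: X) <= rk X + 1.
Proof.
have := @rk_uncross (x |: X) set0 [set x] X; rewrite !sub0set subxx.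
by have := rk_card [set x]; rewrite cards1; move=> ? /(_ isT isT); lia.
Qed.

Lemma rk0 : rk set0 = 0.
Proof. by have := rk_card set0; rewrite cards0; lia. Qed.

(** Throughout, [rk M (Z :|: X) <= rk M X] stands for Z being inside the closure of X, which makes
    this the monotonicity of closure. *)
Lemma rk_cl_mono X Y Z : X \subset Y -> rk (Z :|: X) <= rk X -> rk (Z :|: Y) <= rk Y.
Proof.
move=> sXY h; have := @rk_uncross (Z :|: Y) X (Z :|: X) Y.
have -> : Z :|: Y \subset Z :|: X :|: Y by setb.
have -> : X \subset (Z :|: X) :&: Y by setb.
by move=> /(_ isT isT); lia.
Qed.

Lemma rk_cl X Z : (forall z, z \in Z -> rk (z |: X) <= rk X) -> rk (Z :|: X) <= rk X.
Proof.
elim: {Z}_.+1 {-2}Z (ltnSn #|Z|) => // n IH Z lt h.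
have [->|[z zZ]] := set_0Vmem Z; first by rewrite set0U.
rewrite -(setD1K zZ) -setUA; apply: leq_trans (rk_cl_mono (X := X) _ _) _.
- by rewrite subsetUr.
- exact: h.
- apply: IH => [|y]; first by move: lt; rewrite (cardsD1 z) zZ; lia.
  by rewrite inE => /andP[_]; exact: h.
Qed.

Lemma rk_cl_le X Z : (forall z, z \in Z -> rk (z |: X) <= rk X) -> rk Z <= rk X.
Proof. by move=> /rk_cl; apply: leq_trans; rewrite rkS ?subsetUl. Qed.

End Rank.

Arguments rk : simpl never.

Ltac uncross M A B X Y :=
  let hU := fresh "hU" in
  let hI := fresh "hI" in
  have hU : A \subset X :|: Y; [by setb |
  have hI : B \subset X :&: Y; [by setb |
  have := @rk_uncross _ M A B X Y hU hI; clear hU hI]].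

(** * Connectivity, simplification and duality *)

Lemma rk_delete (T : finType) (M : matroid T) (D X : {set T}) :
  rk (delete M D) X = rk M (X :\: D).
Proof. by rewrite /rk /=; congr rank; setb. Qed.

Lemma rk_contract (T : finType) (M : matroid T) (C X : {set T}) :
  rk (contract M C) X = rk M (X :|: C) - rk M C.
Proof.
rewrite /rk /= /contract_rank; congr (rank _ _ - _); setb.
Qed.

Section Connectivity.
Variables (T : finType) (M : matroid T).
Implicit Types (A B X Y Z : {set T}) (x y e : T).
Notation E := (ground M).

(** [B] need only cover the complement of [A], so it may be enlarged by elements that it spans; the
    cardinalities are those of [A] and of its true complement. *)
Lemma connected_rk k A B : 0 < k < 3 -> connected 3 M -> A \subset E ->
  E \subset A :|: B -> k <= #|A| -> k <= #|E :\: A| ->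
  rk M E + k <= rk M A + rk M B.
Proof.
move=> k3 M3 sA sE cA cB; rewrite leqNgt; apply/negP => lt.
have := rkS M (X := E :\: A) (Y := B); rewrite subDset sE => /(_ isT) lB.
apply: (M3 k k3); exists A; apply/and4P; split=> //.
rewrite /connectivity -!rk_rank ?subsetDl //; rlia.
Qed.

Definition connected_rk1 A B := @connected_rk 1 A B isT.
Definition connected_rk2 A B := @connected_rk 2 A B isT.

(** The connectivity function is self-dual: the cardinalities in the dual ranks of the two sides add
    up to |E|. *)
Lemma connected_dual : connected 3 M -> connected 3 (dual M).
Proof.
move=> M3 k k3 [X /and4P[/= sX lt c1 c2]]; apply: (M3 k k3).
exists X; apply/and4P; split=> //; move: lt; rewrite /connectivity /= /dual_rank.
have -> : E :\: (E :\: X) = X by setb.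
rewrite setDv.
have dX := cardsD E X; rewrite (setIidPr sX) in dX.
have := rank_mono sX (subxx E); have := rank_mono (subsetDl E X) (subxx E).
have := rank_submod sX (subsetDl E X).
have -> : X :|: (E :\: X) = E by setb.
have := rank_le_card sX; have := rank_le_card (subsetDl E X).
have := rank_le_card (sub0set E); have := rank_le_card (subxx E); rewrite cards0.
have := subset_leq_card sX.
rlia.
Qed.

(* Unlike in [connected], the sides are measured by rank, so that loops and
   parallel classes do not matter. *)
Definition vertically_connected := forall X k, X \subset E -> 0 < k < 3 ->
  k <= rk M X -> k <= rk M (E :\: X) -> rk M E + k <= rk M X + rk M (E :\: X).

Definition simples := transversal (parallel_classes M) (nonloops M).

Lemma ground_si : ground (si M) = simples.
Proof.
have tr := transversalP (parallel_classes_partition M).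
rewrite /= setDDr setDv set0U; apply/setIidPr.
by apply: subset_trans (transversal_sub tr) _; apply/subsetP=> z;
  rewrite inE => /andP[].
Qed.

Lemma simples_nonloops : simples \subset nonloops M.
Proof. exact: transversal_sub (transversalP (parallel_classes_partition M)). Qed.

Lemma nonloops_sub : nonloops M \subset E.
Proof. by apply/subsetP=> z; rewrite inE => /andP[]. Qed.

Lemma simples_sub : simples \subset E.
Proof. exact: subset_trans simples_nonloops nonloops_sub. Qed.

Lemma rk_nonloop e : e \in nonloops M -> rk M [set e] = 1.
Proof. by move=> eN; have [se re] := nonloopsP eN; rewrite rk_rank. Qed.

Lemma nonloopE e : (e \in nonloops M) = (e \in E) && (rk M [set e] == 1).
Proof.
apply/idP/andP => [eN | [eE /eqP r1]].
  by rewrite rk_nonloop // (subsetP nonloops_sub).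
by rewrite inE eE /loop eE /= -rk_rank ?sub1set // r1.
Qed.

Lemma parallel_rk e f : e \in E -> f \in E -> parallel M e f = (rk M [set e; f] == 1).
Proof. by move=> eE fE; rewrite /parallel -rk_rank // subUset !sub1set eE. Qed.

Lemma simples_inj e f : e \in simples -> f \in simples ->
  rk M [set e; f] <= 1 -> e = f.
Proof.
move=> eS fS h; have eN := subsetP simples_nonloops _ eS.
have fN := subsetP simples_nonloops _ fS.
have pa := parallel_classes_partition M.
apply: (pblock_inj (transversalP pa)) => //; apply/eqP.
have [_ tr _] := and3P pa.
rewrite eq_pblock //; last by rewrite (cover_partition pa).
rewrite pblock_equivalence_partition //; last exact: parallel_equiv.
rewrite /= parallel_rk ?(subsetP nonloops_sub) //.
have := rk_nonloop eN; have := rkS M (X := [set e]) (Y := [set e; f]).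
by rewrite subsetUl => /(_ isT); rlia.
Qed.

Definition simple_rep e := transversal_repr e simples (pblock (parallel_classes M) e).

Lemma simple_repP e : e \in nonloops M ->
  simple_rep e \in simples /\ rk M [set e; simple_rep e] = 1.
Proof.
move=> eN; have pa := parallel_classes_partition M.
have tr := transversalP pa.
have pb : pblock (parallel_classes M) e \in parallel_classes M.
  by rewrite pblock_mem // (cover_partition pa).
split; first exact: (repr_mem_transversal tr).
have := repr_mem_pblock tr e pb.
set t := transversal_repr _ _ _ => te.
have tN : t \in nonloops M.
  rewrite -(cover_partition pa) /cover; apply/bigcupP.
  by exists (pblock (parallel_classes M) e).
move: te; rewrite pblock_equivalence_partition //=; last exact: parallel_equiv.
by rewrite parallel_rk ?(subsetP nonloops_sub) // => /eqP.
Qed.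

(** A nonloop is spanned by its representative; for a loop the premise is vacuous and the rank
    cannot grow. *)
Lemma simples_rk_cl e A : e \in E ->
  (e \in nonloops M -> simple_rep e \in A) -> rk M (e |: A) <= rk M A.
Proof.
move=> eE h; have [eN|eL] := boolP (e \in nonloops M).
  have [tS ret] := simple_repP eN; apply: (@rk_cl_mono _ _ [set simple_rep e]).
    by rewrite sub1set h.
  by rewrite ret (rk_nonloop (subsetP simples_nonloops _ tS)).
have := @rk_uncross _ M (e |: A) set0 [set e] A; rewrite subxx sub0set => /(_ isT isT).
have := rk_card M [set e]; rewrite cards1.
by move: eL; rewrite nonloopE eE /=; rlia.
Qed.

Lemma simple_rep_id e : e \in simples -> simple_rep e = e.
Proof.
move=> eS; have eN := subsetP simples_nonloops _ eS.
by have [tS ret] := simple_repP eN; apply: simples_inj => //; rewrite setUC ret.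
Qed.

Lemma rk_simples : rk M simples = rk M E.
Proof.
apply/eqP; rewrite eqn_leq rkS ?simples_sub //=; apply: rk_cl_le => z zE.
by apply: simples_rk_cl => // zN; exact: (simple_repP zN).1.
Qed.

Lemma rk_si X : X \subset simples -> rk (si M) X = rk M X.
Proof.
move=> sX; rewrite rk_delete -/simples; congr rk; apply/setP=> z; rewrite !in_setD.
by case zX: (z \in X); rewrite ?andbF // (subsetP sX _ zX).
Qed.

Lemma simples_card X : X \subset simples -> rk M X < #|X| -> 2 < #|X|.
Proof.
move=> sX; rewrite !ltnNge; apply: contra => c2.
have [c1|c1] := leqP #|X| 1.
  have [->|[e eX]] := set_0Vmem X; first by rewrite cards0.
  have eN := subsetP simples_nonloops _ (subsetP sX _ eX).
  apply: leq_trans c1 _; rewrite -(rk_nonloop eN); apply: rkS; by rewrite sub1set.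
have /card_gt1P[u [v [uX vX uv]]] := c1.
rewrite (leq_trans c2) // ltnNge; apply: contra uv => lt2; apply/eqP/simples_inj;
  rewrite ?(subsetP sX) //.
by apply: leq_trans lt2; apply: rkS; rewrite subUset !sub1set uX.
Qed.

(** A separation of si(M) is blown up to whole parallel classes, which keeps the ranks of both
    sides. *)
Lemma si_connected : vertically_connected -> connected 3 (si M).
Proof.
move=> vM k k3 [A]; rewrite /separation ground_si => /and4P[sA lt cA cB].
have sAE := subset_trans sA simples_sub.
(* Loops fall into the complement of [A'], where they do not change the rank. *)
pose A' := [set e in E | (e \in nonloops M) && (simple_rep e \in A)].
have A'E z : (z \in A') = [&& z \in E,
  z \in nonloops M & simple_rep z \in A] by rewrite in_set.
have sA' : A' \subset E by apply/subsetP=> z; rewrite A'E => /andP[].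
have rA : rk M A' <= rk M A.
  apply: rk_cl_le => z.
  by rewrite A'E => /and3P[zE _ zA]; apply: simples_rk_cl.
have rB : rk M (E :\: A') <= rk M (simples :\: A).
  apply: rk_cl_le => z.
  rewrite in_setD A'E => /andP[zA' zE]; apply: simples_rk_cl => // zN.
  by rewrite inE (simple_repP zN).1 andbT; apply: contra zA' => zA; rewrite zE zN zA.
have AA' : A \subset A'.
  apply/subsetP=> z zA; have zS := subsetP sA _ zA.
  by rewrite A'E (subsetP sAE) // (subsetP simples_nonloops) // simple_rep_id.
have BB' : simples :\: A \subset E :\: A'.
  apply/subsetP=> z; rewrite !in_setD A'E => /andP[zA zS];
    rewrite (subsetP simples_sub) // andbT.
  by rewrite (simple_rep_id zS) (negPf zA) !andbF.
have lt' : rk M A' + rk M (E :\: A') < rk M E + k.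
  move: lt; rewrite /connectivity ground_si /= -!rk_rank ?simples_sub
    ?(subset_trans (subsetDl _ _) simples_sub) //.
  have := rk_simples; rlia.
(* In a simple matroid one element has rank 1 and two have rank 2, so for k at most 2 a side large
   in cardinality is large in rank. *)
have gt1 (Z : {set T}) : k <= #|Z| -> Z \subset simples -> k <= rk M Z.
  move=> cZ sZ; have /card_gt0P[a aZ] : 0 < #|Z| by rlia.
  have ra := rk_nonloop (subsetP simples_nonloops _ (subsetP sZ _ aZ)).
  have [k1|k2] := leqP k 1.
    by have := rkS M (X := [set a]) (Y := Z); rewrite sub1set aZ => /(_ isT); rlia.
  have /card_gt1P[u [v [uZ vZ uv]]] : 1 < #|Z| by rlia.
  rewrite leqNgt; apply: contra uv => lt2; apply/eqP/simples_inj;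
    rewrite ?(subsetP sZ) //.
  have := rkS M (X := [set u; v]) (Y := Z);
    rewrite subUset !sub1set uZ vZ => /(_ isT); rlia.
have := vM A' k sA' k3; have := rk_simples.
have := gt1 _ cA sA; have := gt1 _ cB (subsetDl _ _).
have := rkS M AA'; have := rkS M BB'; rlia.
Qed.

End Connectivity.

Lemma rk_dual (T : finType) (M : matroid T) (X : {set T}) :
  rk (dual M) X + rk M (ground M) = #|X :&: ground M| + rk M (ground M :\: X).
Proof.
rewrite /rk /= /dual_rank setIid.
have -> : ground M :\: (X :&: ground M) = ground M :\: X by setb.
have -> : (ground M :\: X) :&: ground M = ground M :\: X by setb.
rewrite subnK //; have := rank_submod (subsetIr X (ground M)) (subsetDl (ground M) X).
have -> : X :&: ground M :|: ground M :\: X = ground M by setb.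
have := rank_le_card (subsetIr X (ground M)); rlia.
Qed.

Lemma rk_dual_dual (T : finType) (N : matroid T) (X : {set T}) :
  rk (dual (dual N)) X = rk N X.
Proof.
have := rk_dual (dual N) X; have /= := rk_dual N (ground N :\: X);
  have := rk_dual N (ground N).
have -> : ground N :\: (ground N :\: X) = X :&: ground N by setb.
have -> : (ground N :\: X) :&: ground N = ground N :\: X by setb.
rewrite /= setDv rk0 setIid.
have -> : rk N (X :&: ground N) = rk N X by rewrite /rk -setIA setIid.
have := cardsID X (ground N); rewrite [ground N :&: X]setIC; rlia.
Qed.

(** * Minors *)

Section Embedding.
Variables (T T' : finType).
Implicit Types (M : matroid T) (N : matroid T') (C F X : {set T}) (f : T -> T').

(* [f] is an isomorphism from the restriction of M / C to F onto N. *)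
Definition minor_map M N C F f := [/\ C \subset ground M, F \subset ground M,
  [disjoint C & F], {in F &, injective f} &
  f @: F = ground N /\
  forall X, X \subset F -> rk N (f @: X) + rk M C = rk M (X :|: C)].

Lemma has_minor_map M N : 0 < #|ground N| -> has_minor M N ->
  exists C F f, minor_map M N C F f.
Proof.
move=> /card_gt0P[y0 _] [C [D [sC sD dCD [f [bf rf]]]]].
set K := delete (contract M C) D in f bf rf.
(* [y0] is a filler outside the ground set of [K]; this is where N has to be nonempty. *)
pose g x := if insub x is Some u then val (f u) else y0.
have gE u : g (val u) = val (f u) by rewrite /g valK.
have gS x (xK : x \in ground K) : g x = val (f (Sub x xK)).
  by rewrite /g insubT.
have gX X : X \subset ground K -> g @: X = [set val (f x) | x in val @^-1: X].
  move=> sX; apply/setP=> y; apply/imsetP/imsetP => [[x xX ->]|[u uX ->]].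
    have xK := subsetP sX _ xX.
    by exists (Sub x xK); rewrite ?inE // gS.
  by exists (val u); rewrite ?gE //; move: uX; rewrite inE.
have vX X : X \subset ground K ->
    [set val (x : {x | x \in ground K}) | x in val @^-1: X] = X.
  move=> sX; apply/setP=> x; apply/imsetP/idP => [[u uX ->]|xX].
    by move: uX; rewrite inE.
  by exists (Sub x (subsetP sX _ xX)); rewrite ?inE.
exists C, (ground K), g; split=> //.
- by apply/subsetP=> z; rewrite !inE => /and3P[].
- by rewrite disjoints_subset; apply/subsetP=> z; rewrite !inE => ->; rewrite /= andbF.
- move=> x y xK yK; rewrite !gS.
  by move=> /val_inj/(bij_inj bf)[].
split.
  apply/setP=> y; apply/imsetP/idP => [[x xK ->]|yN].
    by rewrite gS; exact: valP.
  have [h fh hf] := bf.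
  by exists (val (h (Sub y yN))); rewrite ?gE ?hf //; exact: valP.
move=> X sX; rewrite gX // rk_rank; last first.
  by apply/subsetP=> _ /imsetP[u _ ->]; exact: valP.
rewrite rf vX // /K /= -[contract_rank M C X]/(rank (contract M C) X).
rewrite -rk_rank; last by move: sX; rewrite /= subsetD => /andP[].
by rewrite rk_contract subnK // rkS // subsetUr.
Qed.

Lemma minor_map_has_minor M N C F f : minor_map M N C F f -> has_minor M N.
Proof.
move=> [sC sF dCF inj [fF rf]].
pose D := ground M :\: C :\: F.
have eF : ground (delete (contract M C) D) = F.
  by move: dCF; rewrite disjoints_subset => dCF; rewrite /= /D; setb.
exists C, D; split=> //.
- by rewrite /D; setb.
- by rewrite /D disjoints_subset; setb.
have gP (u : {x : T | x \in ground (delete (contract M C) D)}) : f (val u) \in ground N.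
  by rewrite -fF imset_f // -eF; exact: valP.
exists (fun u => Sub (f (val u)) (gP u)); split.
  apply: inj_card_bij => [u v [/inj fuv]|].
    by apply/val_inj/fuv; rewrite -eF; exact: valP.
  rewrite !card_sig.
  have -> : #|[pred y | y \in ground N]| = #|F| by rewrite -(card_in_imset inj) fF;
    apply: eq_card.
  by rewrite -[in X in X <= _]eF; apply/eq_leq/eq_card.
move=> X; set X' := [set val x | x in X].
have sX' : X' \subset F by rewrite -eF; apply/subsetP=> _ /imsetP[u _ ->]; exact: valP.
have -> : [set val (Sub (f (val u)) (gP u) : {y :
  T' | y \in ground N}) | u in X] = f @: X'.
  by rewrite -imset_comp.
have := rf _ sX'.
rewrite rk_rank; last by rewrite -fF imsetS.
have := rkS M (subsetUr X' C).
have -> : rank (delete (contract M C) D) X' = rk M (X' :|: C) - rk M C.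
  rewrite -rk_contract -[LHS]/(rank (contract M C) X') -rk_rank //.
  by apply: subset_trans sX' _; rewrite -eF subsetDl.
by lia.
Qed.

End Embedding.

Section MinorMaps.
Variables (T T' : finType).
Implicit Types (M : matroid T) (N : matroid T') (C F W X : {set T}) (f : T -> T').

Section Connected.
Variables (M : matroid T) (N : matroid T') (C F : {set T}) (f : T -> T').
Hypotheses (N3 : connected 3 N) (mF : minor_map M N C F f).

Lemma minor_map_card : #|F| = #|ground N|.
Proof. by have [_ _ _ inj [<- _]] := mF; rewrite card_in_imset. Qed.

Lemma minor_map_cardD W : W \subset F -> #|ground N :\: f @: W| = #|F :\: W|.
Proof.
have [_ _ _ inj [fF _]] := mF => sW;
  have sfW : f @: W \subset ground N by rewrite -fF imsetS.
rewrite !cardsD (setIidPr sW) (setIidPr sfW) minor_map_card card_in_imset //.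
by move=> x y xW yW; apply: inj; exact: (subsetP sW).
Qed.

(** The connectivity of N read in M: contracting [C] subtracts [rk M C] twice on the right and once
    on the left. *)
Lemma minor_map_connected k W : 0 < k < 3 -> W \subset F ->
  k <= #|W| -> k <= #|F :\: W| ->
  rk M (F :|: C) + rk M C + k <= rk M (W :|: C) + rk M (F :\: W :|: C).
Proof.
have [_ _ _ inj [fF rf]] := mF => k3 sW cW cD.
have sfW : f @: W \subset ground N by rewrite -fF imsetS.
have := @connected_rk _ N k (f @: W) (f @: (F :\: W)) k3 N3 sfW.
have -> : ground N \subset f @: W :|: f @: (F :\: W).
  have eU : W :|: (F :\: W) = F by setb.
  by rewrite -imsetU eU fF.
rewrite minor_map_cardD // card_in_imset ?cW ?cD; last first.
  by move=> x y xW yW; apply: inj; exact: (subsetP sW).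
move=> /(_ isT isT isT); have := rf _ sW; have := rf _ (subsetDl F W).
by have := rf _ (subxx F); rewrite fF; rlia.
Qed.

Definition minor_map_connected1 W := @minor_map_connected 1 W isT.
Definition minor_map_connected2 W := @minor_map_connected 2 W isT.

Hypothesis N4 : 4 <= #|ground N|.

Lemma minor_map_nonloop e : e \in F -> rk M C < rk M (e |: C).
Proof.
move=> eF; have sF : [set e] \subset F by rewrite sub1set.
have := minor_map_connected1 sF; rewrite cardsDS // cards1 minor_map_card.
have := rkS M (setSU C (subsetDl F [set e])); rlia.
Qed.

Lemma minor_map_nonparallel e e' : e \in F -> e' \in F -> e != e' ->
  rk M C + 2 <= rk M ([set e; e'] :|: C).
Proof.
move=> eF eF' ne; have sF : [set e; e'] \subset F by rewrite subUset !sub1set eF.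
have := minor_map_connected2 sF; rewrite cardsDS // cards2 ne minor_map_card.
have := rkS M (setSU C (subsetDl F [set e; e'])); rlia.
Qed.

(* The connectivity of N is at most that of M / s for every s in C. *)
Lemma minor_map_sides (A B : {set T}) s : s \in C -> s \in A -> s \in B ->
  ground M \subset A :|: B -> A :&: B \subset [set s] ->
  rk M A + rk M B <= rk M (ground M) + rk M [set s] + 1 ->
  (#|F :&: A| <= 1) || (#|F :\: A| <= 1).
Proof.
have [sC sF dCF _ _] := mF => sIC sA sB sE sI h.
apply: contraT; rewrite negb_or -!ltnNge => /andP[c1 c2].
have := minor_map_connected2 (subsetIl F A); rewrite setDIr setDv set0U => /(_ c1 c2).
have h1 := rk_submod M A C; have h2 := rk_submod M B C.
have := @rk_uncross _ M C [set s] (A :&: C) (B :&: C).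
have -> : C \subset A :&: C :|: B :&: C by setb.
have -> : [set s] \subset A :&: C :&: (B :&: C) by setb.
move=> /(_ isT isT).
have := @rk_uncross _ M (A :|: C :|: F :\: A) (F :&: A :|: C) (A :|: C) (F :|: C).
have -> : A :|: C :|: F :\: A \subset A :|: C :|: (F :|: C) by setb.
have -> : F :&: A :|: C \subset (A :|: C) :&: (F :|: C) by setb.
move=> /(_ isT isT).
have := @rk_uncross _ M (ground M) (F :\: A :|: C) (A :|: C :|: F :\: A) (B :|: C).
have -> : ground M \subset A :|: C :|: F :\: A :|: (B :|: C) by setb.
have -> : F :\: A :|: C \subset (A :|: C :|: F :\: A) :&: (B :|: C) by setb.
move=> /(_ isT isT).
rlia.
Qed.
End Connected.

(** N is simple, being 3-connected with at least four elements. So [F] has no loops and at most one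
    element of each parallel class, and both [C] and [F] can be moved to representatives without
    changing any rank involved. *)
Lemma minor_map_si M N C F f : connected 3 N -> 4 <= #|ground N| ->
  minor_map M N C F f -> has_minor (si M) N.
Proof.
move=> N3 N4 mF; have [sC sF dCF inj [fF rf]] := mF.
pose C' := @simple_rep _ M @: (C :&: nonloops M).
have Fnl e : e \in F -> e \in nonloops M.
  move=> eF; rewrite nonloopE (subsetP sF) //=; have := minor_map_nonloop N3 mF N4 eF.
  have := rk_card M [set e]; rewrite cards1; have := rk_submod M [set e] C; rlia.
have par e e' : e \in nonloops M -> e' \in nonloops M ->
  simple_rep M e = simple_rep M e' ->
    rk M [set e; e'] <= 1.
  move=> eN eN' ee; have [tS r1] := simple_repP eN; have [_] := simple_repP eN';
    rewrite -ee => r2.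
  have rt := rk_nonloop (subsetP (simples_nonloops M) _ tS).
  have := @rk_uncross _ M [set e; e'] [set simple_rep M e] [set e;
    simple_rep M e] [set e'; simple_rep M e].
  rewrite r1 r2 rt => h.
  suff : 1 + rk M [set e; e'] <= 2 by rlia.
  rewrite addnC; apply: h; first by setb.
  by rewrite sub1set !inE !eqxx !orbT.
have repF : {in F &, injective (simple_rep M)}.
  move=> e e' eF eF' /(par e e' (Fnl _ eF) (Fnl _ eF')) r1; apply/eqP;
    apply: contraT => ne.
  have := minor_map_nonparallel N3 mF N4 eF eF' ne; have := rk_submod M [set e;
    e'] C; rlia.
have rkE X : X \subset F -> rk M (simple_rep M @: X :|: C') = rk M (X :|: C).
  move=> sX; have XN e : e \in X -> e \in nonloops M by move=> /(subsetP sX);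
    exact: Fnl.
  apply/eqP; rewrite eqn_leq; apply/andP; split; apply: rk_cl_le => z.
    have repz e : e \in X :|: C -> e \in nonloops M ->
      rk M (simple_rep M e |: (X :|: C)) <= rk M (X :|: C).
      move=> eX eN; apply: (@rk_cl_mono _ _ [set e]); first by rewrite sub1set.
      by rewrite setUC (simple_repP eN).2 (rk_nonloop eN).
    case/setUP=> /imsetP[e eX ->]; first by apply: repz; rewrite ?XN // inE eX.
    by have /setIP[eC eN] := eX; apply: repz; rewrite // inE eC orbT.
  case/setUP=> [zX|zC].
    apply: simples_rk_cl => [|_]; first by rewrite (subsetP sF) // (subsetP sX).
    by apply/setUP; left; apply: imset_f.
  apply: simples_rk_cl => [|zN]; first by rewrite (subsetP sC).
  by apply/setUP; right; apply: imset_f; rewrite in_setI zC.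
have rkC : rk M C' = rk M C by have := rkE set0 (sub0set _); rewrite imset0 !set0U.
have sub_si (X : {set T}) : X \subset nonloops M -> simple_rep M @: X \subset simples M.
  by move=> sX; apply/subsetP=> _ /imsetP[e /(subsetP sX) eN ->];
    exact: (simple_repP eN).1.
have sC' : C' \subset simples M by apply: sub_si; exact: subsetIr.
have sF' : simple_rep M @: F \subset simples M by apply: sub_si; apply/subsetP.
(* [f'] is [f] after the inverse of [simple_rep M] on [F]; its value elsewhere is a filler. *)
pose f' t := if [pick e in F | simple_rep M e == t] is Some e then f e else f t.
have f'E e : e \in F -> f' (simple_rep M e) = f e.
  move=> eF; rewrite /f'; case: pickP => [e' /andP[eF' /eqP/repF -> //]|/(_ e)].
  by rewrite eF eqxx.
have f'X (X : {set T}) : X \subset F -> f' @: (simple_rep M @: X) = f @: X.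
  by move=> sX; rewrite -imset_comp; apply: eq_in_imset => e eX; apply/f'E/(subsetP sX).
apply: (@minor_map_has_minor _ _ _ _ C' (simple_rep M @: F) f'); split;
  rewrite ?ground_si //.
- rewrite disjoints_subset; apply/subsetP=> _ /imsetP[c /setIP[cC cN] ->].
  rewrite inE; apply/imsetP=> [[e eF /(par _ _ cN (Fnl _ eF)) r1]].
  have := minor_map_nonloop N3 mF N4 eF.
  have : rk M (e |: C) <= rk M C.
    apply: (@rk_cl_mono _ _ [set c]); first by rewrite sub1set.
    by rewrite setUC (rk_nonloop cN).
  by rlia.
- by move=> _ _ /imsetP[e eF ->] /imsetP[e' eF' ->]; rewrite !f'E // => /inj ->.
split=> [|Y sY]; first by rewrite f'X.
have -> : Y = simple_rep M @: [set e in F | simple_rep M e \in Y].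
  apply/setP=> y; apply/idP/imsetP => [yY|[e]]; last by rewrite inE => /andP[_ eY] ->.
  have /imsetP[e eF ye] := subsetP sY _ yY.
  by exists e => //; rewrite inE eF -ye.
set X := [set e in F | _]; have sX : X \subset F by apply/subsetP=> z;
  rewrite inE => /andP[].
have sXs : simple_rep M @: X \subset simples M by apply: subset_trans sF';
  exact: imsetS.
by rewrite f'X // !rk_si ?rkE ?subUset ?sXs // rkC rf.
Qed.

(** Duality exchanges deletion and contraction: the elements outside [C] and [F], deleted in M, are
    the ones contracted in the dual. *)
Lemma minor_map_dual M N C F f : minor_map M N C F f ->
  minor_map (dual M) (dual N) (ground M :\: C :\: F) F f.
Proof.
move=> mF; have [sC sF dCF inj [fF rf]] := mF.
rewrite disjoints_subset in dCF.
split=> //.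
- by rewrite /=; setb.
- by rewrite disjoints_subset; setb.
split=> // X sX.
have sfX : f @: X \subset ground N by rewrite -fF imsetS.
have := rk_dual N (f @: X); rewrite (setIidPl sfX) card_in_imset; last first.
  by move=> x y xX yX; apply: inj; exact: (subsetP sX).
have -> : ground N :\: f @: X = f @: (F :\: X).
  apply/setP=> y; rewrite in_setD -fF; apply/andP/imsetP => [[yX /imsetP[e eF ye]]|[e]].
    by exists e => //; rewrite inE eF andbT; apply: contra yX => eX; rewrite ye imset_f.
  rewrite inE => /andP[eX eF] ->; split; last exact: imset_f.
  by apply: contra eX => /imsetP[e' eX' /inj -> //]; exact: (subsetP sX).
have := rf _ (subsetDl F X); have := rf _ (subxx F); rewrite fF.
set D := _ :\: _ :\: _.
have := rk_dual M D; have := rk_dual M (X :|: D).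
have -> : D :&: ground M = D by rewrite /D; setb.
have -> : (X :|: D) :&: ground M = X :|: D by rewrite /D; setb.
have -> : ground M :\: D = F :|: C by rewrite /D; setb.
have -> : ground M :\: (X :|: D) = F :\: X :|: C by rewrite /D; setb.
have -> : #|X :|: D| = #|X| + #|D|.
  have := cardsUI X D; have -> : X :&: D = set0 by rewrite /D; setb.
  by rewrite cards0 addn0.
rlia.
Qed.

Lemma has_minor_si M N : connected 3 N -> 4 <= #|ground N| -> has_minor M N ->
  has_minor (si M) N.
Proof.
move=> N3 N4 /has_minor_map[|C [F [f mF]]]; first by rlia.
exact: minor_map_si mF.
Qed.

(** Simplification of the dual, between two uses of [minor_map_dual]. It is enough that the double
    dual of N has the ground set and the [rk] of N, since a minor map compares nothing else. *)
Lemma has_minor_co M N : connected 3 N -> 4 <= #|ground N| -> has_minor M N ->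
  has_minor (co M) N.
Proof.
move=> N3 N4 /has_minor_map[|C [F [f /minor_map_dual mF]]]; first by rlia.
have /has_minor_map[|C' [F' [f' /minor_map_dual [sC sF dCF inj [fF rf]]]]] :
  has_minor (si (dual M)) (dual N) := minor_map_si (connected_dual N3) N4 mF.
  by rewrite /=; rlia.
apply: minor_map_has_minor; split;
  [exact: sC|exact: sF|exact: dCF|exact: inj|split=> //].
by move=> X /rf <-; rewrite rk_dual_dual.
Qed.

Lemma minor_map_contract M N C F f x : x \in ground M ->
  minor_map (contract M [set x]) N C F f -> minor_map M N (x |: C) F f.
Proof.
move=> xE [sC sF dCF inj [fF rf]]; rewrite disjoints_subset /= in dCF sC sF.
split=> //.
- by setb.
- by setb.
- by rewrite disjoints_subset; setb.
split=> // X sX; have := rf X sX; rewrite !rk_contract -setUA [C :|: _]setUC.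
have := @rkS _ M [set x] (X :|: (x |: C)); have := @rkS _ M [set x] (x |: C).
rewrite !sub1set !inE eqxx !orbT => /(_ isT) ? /(_ isT); rlia.
Qed.

Lemma minor_map_contracted M N C F f x : x \in C ->
  minor_map M N C F f -> minor_map (contract M [set x]) N (C :\ x) F f.
Proof.
move=> xC [sC sF dCF inj [fF rf]]; rewrite disjoints_subset in dCF.
split=> //.
- by rewrite /=; setb.
- by rewrite /=; setb.
- by rewrite disjoints_subset; setb.
split=> // X sX; have := rf X sX;
  rewrite !rk_contract -setUA [C :\ x :|: _]setUC setD1K //.
have := @rkS _ M [set x] (X :|: C); have := @rkS _ M [set x] C.
rewrite !sub1set !inE xC !orbT => /(_ isT) ? /(_ isT); rlia.
Qed.

End MinorMaps.

(** * Two-separations *)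

Section TwoSeparation.
Variables (T : finType) (K : matroid T) (X Y : {set T}).
Implicit Types (U W Z : {set T}) (e s : T).
Hypotheses (XY : X :|: Y = ground K) (dXY : Y \subset ~: X).
Hypothesis sep : rk K X + rk K Y = rk K (ground K) + 1.

(* K is a 2-sum of its two sides along a basepoint p, up to parallel copies:
   p is spanned by a subset W of X exactly when r(W :|: Y) < r(W) + r(Y). *)
Definition spans_basepoint W := rk K (W :|: Y) < rk K W + rk K Y.

(** The two sides share only the basepoint, so ranks add up, less one when [W] and [U] both span it.
    The second conjunct is the condition that [U] spans it. *)
Lemma twosep_rk U W : U \subset Y -> W \subset X ->
  rk K (W :|: U) + (spans_basepoint W && (rk K (X :|: U) < rk K X + rk K U)) =
  rk K W + rk K U.
Proof.
move=> sU sW; rewrite /spans_basepoint.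
have f1 := @rk_uncross _ K (W :|: Y) U (W :|: U) Y.
have f2 := @rk_uncross _ K (X :|: U) W (W :|: U) X.
have f3 := @rk_uncross _ K (ground K) (W :|: U) (W :|: Y) (X :|: U).
have e1 : W :|: Y \subset W :|: U :|: Y by setb.
have e2 : U \subset (W :|: U) :&: Y by setb.
have e3 : X :|: U \subset W :|: U :|: X by setb.
have e4 : W \subset (W :|: U) :&: X by setb.
have e5 : ground K \subset W :|: Y :|: (X :|: U) by rewrite -XY; setb.
have e6 : W :|: U \subset (W :|: Y) :&: (X :|: U) by setb.
move: (f1 e1 e2) (f2 e3 e4) (f3 e5 e6) => {}f1 {}f2 {}f3.
have := rk_submod K W U; have := rk_submod K W Y; have := rk_submod K X U.
have e7 : ground K \subset W :|: Y :|: X by rewrite -XY; setb.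
have e8 : W \subset (W :|: Y) :&: X by setb.
have := rk_uncross K e7 e8.
case: ltnP; case: ltnP => /=; rlia.
Qed.

Lemma spans_basepointS W Z : W \subset Z -> spans_basepoint W -> spans_basepoint Z.
Proof.
move=> sWZ; rewrite /spans_basepoint => h.
have := @rk_uncross _ K (Z :|: Y) W (W :|: Y) Z.
have -> : Z :|: Y \subset W :|: Y :|: Z by setb.
have -> : W \subset (W :|: Y) :&: Z by setb.
by move=> /(_ isT isT); rlia.
Qed.

Lemma rk_spans_basepointU1 W e : ~~ spans_basepoint W -> spans_basepoint (e |: W) ->
  rk K (e |: W) = rk K W + 1.
Proof.
rewrite /spans_basepoint => n1 s1; have := rkU1 K e W;
  have := rkS K (subsetUr [set e] W).
have := @rkS _ K (W :|: Y) (e |: W :|: Y);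
  have -> : W :|: Y \subset e |: W :|: Y by setb.
by move=> /(_ isT); rlia.
Qed.

(** [X] itself spans the basepoint because of [sep], so a maximal set avoiding it is proper. *)
Lemma max_avoid_basepoint s : s \in X -> ~~ spans_basepoint [set s] ->
  exists W e, [/\ s \in W, W \subset X, e \in X :\: W, ~~ spans_basepoint W
    & spans_basepoint (e |: W)].
Proof.
move=> sX ns.
pose P := [pred W : {set T} | [&& s \in W, W \subset X & ~~ spans_basepoint W]].
have Ps : P [set s] by rewrite /= inE eqxx sub1set sX.
have [W /maxsetP[/and3P[sW WX nW] maxW] _] := maxset_exists Ps.
have /subsetPn[e eX eW] : ~~ (X \subset W).
  apply: contra nW => XW; have -> : W = X by apply/eqP; rewrite eqEsubset WX.
  by rewrite /spans_basepoint XY; rlia.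
exists W, e; rewrite in_setD eX eW; split=> //.
apply: contraT => nWe; have /maxW/(_ (subsetUr _ _)) e1 : P (e |: W).
  by rewrite /= nWe !inE sW orbT subUset sub1set eX WX.
by move: eW; rewrite -e1 setU11.
Qed.

Variables (T' : finType) (N : matroid T') (C F : {set T}) (f : T -> T').
Hypotheses (N3 : connected 3 N) (N4 : 4 <= #|ground N|) (mF : minor_map K N C F f).
Hypothesis small : #|F :&: X| <= 1.

(* If N uses the basepoint, contract a maximal set W containing s and not
   spanning the basepoint; an element e' such that W + e' spans it then takes
   the place of the basepoint. *)
Lemma contractible_small_side s : s \in X -> ~~ spans_basepoint [set s] ->
  exists C' F' f', [/\ minor_map K N C' F' f', s \in C' & #|F' :&: X| <= 1].
Proof.
move=> sX ns; have [sC sF dCF inj [fF rf]] := mF.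
rewrite disjoints_subset in dCF.
have sXE : X \subset ground K by rewrite -XY subsetUl.
have sYE : Y \subset ground K by rewrite -XY subsetUr.
have CE : C = (C :&: X) :|: (C :&: Y) by rewrite -setIUr XY (setIidPl sC).
set CX := C :&: X in CE; set CY := C :&: Y in CE.
have sCX : CX \subset X by exact: subsetIr.
have sCY : CY \subset Y by exact: subsetIr.
have [FX0|[e eFX]] := set_0Vmem (F :&: X).
  have sFY : F \subset Y.
    apply/subsetP=> z zF; have := subsetP sF _ zF; rewrite -XY => /setUP[zX|//].
    have : z \in F :&: X by rewrite inE zF.
    by rewrite FX0 inE.
  (* When [F] misses [X], all that matters about the part contracted in [X] is whether it spans the
     basepoint; [X] and {s} are sets containing s of either kind. *)
  have [W [sW WX eqW]] :
    exists W, [/\ s \in W, W \subset X & spans_basepoint W = spans_basepoint CX].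
    case: (boolP (spans_basepoint CX)) => [bC|nC]; last first.
      by exists [set s]; rewrite inE eqxx sub1set sX; split=> //; apply/negbTE.
    by exists X; rewrite subxx sX; split=> //; rewrite /spans_basepoint XY; rlia.
  have rW U : U \subset Y -> rk K (W :|: U) + rk K CX = rk K (CX :|: U) + rk K W.
    by move=> sU; have := twosep_rk sU WX; have := twosep_rk sU sCX; rewrite eqW; rlia.
  exists (W :|: CY), F, f; split=> //; last by rewrite inE sW.
  split=> //.
  - by setb.
  - by rewrite disjoints_subset; setb.
  split=> // Z sZ; have := rf Z sZ.
  have -> : Z :|: C = CX :|: (CY :|: Z) by rewrite CE; setb.
  have -> : Z :|: (W :|: CY) = W :|: (CY :|: Z) by setb.
  have := rW CY sCY; have sU : CY :|:
    Z \subset Y by rewrite subUset sCY (subset_trans sZ).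
  have := rW _ sU; rewrite [in rk K C]CE; rlia.
have [eF eX] := setIP eFX.
pose F1 := F :\ e.
have FE : F = e |: F1 by rewrite setD1K.
have sF1 : F1 \subset F by exact: subD1set.
have sF1Y : F1 \subset Y.
  apply/subsetP=> z; rewrite !inE => /andP[ze zF].
  have := subsetP sF _ zF; rewrite -XY => /setUP[zX|//].
  by move: small; rewrite (cardsD1 e) eFX (cardsD1 z) !inE ze zF zX; rlia.
have [W [e' [sW WX]]] := max_avoid_basepoint sX ns.
rewrite in_setD => /andP[eW' eX'] nW nWe.
have sWe : e' |: W \subset X by rewrite subUset sub1set eX'.
have seCX : e |: CX \subset X by rewrite subUset sub1set eX.
have sU1 : CY :|: F1 \subset Y by rewrite subUset sCY.
(* Otherwise, by monotonicity, both sets span the basepoint or neither does, and {e} would be a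
   1-separation of N. *)
have [nC nCe] : ~~ spans_basepoint CX /\ spans_basepoint (e |: CX).
  have se : [set e] \subset F by rewrite sub1set.
  have := minor_map_connected1 N3 mF se; rewrite cards1 cardsDS // cards1.
  have -> : 0 < #|F| - 1 by rewrite (minor_map_card mF) subn_gt0 (leq_trans _ N4).
  move=> /(_ isT isT).
  have -> : F :|: C = (e |: CX) :|: (CY :|: F1) by rewrite {1}FE {1}CE; setb.
  have -> : [set e] :|: C = (e |: CX) :|: CY by rewrite {1}CE; setb.
  have -> : F :\ e :|: C = CX :|: (CY :|: F1) by rewrite {1}CE /F1; setb.
  rewrite [in rk K C]CE.
  have := twosep_rk sU1 seCX; have := twosep_rk sCY seCX.
  have := twosep_rk sU1 sCX; have := twosep_rk sCY sCX.
  case bX: (spans_basepoint CX); case bE: (spans_basepoint (e |: CX)) => //=.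
  - by move=> *; exfalso; rlia.
  - by move=> *; have := spans_basepointS (subsetUr [set e] CX) bX; rewrite bE.
  - by move=> *; exfalso; rlia.
have re := rk_spans_basepointU1 nC nCe; have re' := rk_spans_basepointU1 nW nWe.
have eF1' : e' \notin F1 by apply/negP=> /(subsetP sF1Y)/(subsetP dXY); rewrite inE eX'.
pose f' z := if z == e' then f e else f z.
have f'F1 Z : Z \subset F1 -> f' @: Z = f @: Z.
  move=> sZ; apply: eq_in_imset => z zZ; rewrite /f'; case: eqP => // ze.
  by move: eF1'; rewrite -ze (subsetP sZ).
have f'e : f' e' = f e by rewrite /f' eqxx.
exists (W :|: CY), (e' |: F1), f'; split; last first.
- have -> : (e' |: F1) :&: X = [set e'] by setb.
  by rewrite cards1.
- by rewrite inE sW.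
have eF2 z : z \in F1 -> f' z = f z by rewrite /f'; case: eqP => // -> h;
  move: eF1'; rewrite h.
split.
- by setb.
- by rewrite subUset sub1set (subsetP sXE) //=; apply: subset_trans sF.
- rewrite disjoints_subset; apply/subsetP=> z zWC; rewrite inE;
    apply/setU1P=> [[ze|zF]].
    move: zWC; rewrite ze inE (negPf eW') => /(subsetP sCY)/(subsetP dXY).
    by rewrite inE eX'.
  case/setUP: zWC => [/(subsetP WX) zX|];
    first by have := subsetP dXY _ (subsetP sF1Y _ zF); rewrite inE zX.
  by rewrite inE => /andP[/(subsetP dCF)]; rewrite inE (subsetP sF1).
- move=> x y /setU1P[->|xF1] /setU1P[->|yF1] //.
  + rewrite f'e eF2 // => h; move: (yF1).
    by rewrite -(inj _ _ eF (subsetP sF1 _ yF1) h) !inE eqxx.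
  + rewrite f'e eF2 // => h; move: (xF1).
    by rewrite (inj _ _ (subsetP sF1 _ xF1) eF h) !inE eqxx.
  + by rewrite !eF2 // => /inj; apply; exact: (subsetP sF1).
split; first by rewrite imsetU1 f'e f'F1 // -imsetU1 -FE.
have main Z : Z \subset F1 ->
    rk N (f @: Z) + rk K (W :|: CY) = rk K (Z :|: (W :|: CY)) /\
    rk N (f @: (e |: Z)) + rk K (W :|: CY) = rk K (e' |: Z :|: (W :|: CY)).
  move=> sZ; have sZF := subset_trans sZ sF1.
  have seZ : e |: Z \subset F by rewrite subUset sub1set eF.
  have := rf _ sZF; have := rf _ seZ.
  have -> : e |: Z :|: C = (e |: CX) :|: (CY :|: Z) by rewrite {1}CE; setb.
  have -> : Z :|: C = CX :|: (CY :|: Z) by rewrite {1}CE; setb.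
  have -> : e' |: Z :|: (W :|: CY) = (e' |: W) :|: (CY :|: Z) by setb.
  have -> : Z :|: (W :|: CY) = W :|: (CY :|: Z) by setb.
  have sU : CY :|: Z \subset Y by rewrite subUset sCY (subset_trans sZ).
  rewrite [in rk K C]CE.
  have := twosep_rk sCY WX; have := twosep_rk sCY sCX.
  have := twosep_rk sU WX; have := twosep_rk sU sCX.
  have := twosep_rk sU sWe; have := twosep_rk sU seCX.
  by rewrite (negPf nC) (negPf nW) nCe nWe /=; rlia.
move=> Z sZ; have [eZ|eZ] := boolP (e' \in Z); last first.
  have sZ1 : Z \subset F1 by rewrite -(setU1K eF1') subsetD1 sZ.
  by rewrite f'F1 //; exact: (main Z sZ1).1.
have sZ1 : Z :\ e' \subset F1 by rewrite -(setU1K eF1') setSD.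
by rewrite -(setD1K eZ) imsetU1 f'e f'F1 // -imsetU1; exact: (main _ sZ1).2.
Qed.

End TwoSeparation.

(** * Vertical 3-partitions *)

Section Vertical.
Variables (T : finType) (M : matroid T).
Implicit Types (X Y Z S R : {set T}) (x y e s : T).
Notation E := (ground M).
Notation r := (rk M).
Hypotheses (M3 : connected 3 M) (M4 : 4 <= #|ground M|).

Lemma rk_set1 e : e \in E -> r [set e] = 1.
Proof.
move=> eE; have sE : [set e] \subset E by rewrite sub1set.
have sU : E \subset [set e] :|: (E :\ e) by setb.
have := connected_rk1 M3 sE sU;
  rewrite cardsDS // cards1 subn_gt0 (leq_trans _ M4) // => /(_ isT isT).
by have := rk_card M [set e]; have := rkS M (subD1set E e); rewrite cards1; rlia.
Qed.

Lemma rk_set2 e e' : e \in E -> e' \in E -> e != e' -> r [set e; e'] = 2.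
Proof.
move=> eE eE' ne; have sE : [set e; e'] \subset E by rewrite subUset !sub1set eE.
have sU : E \subset [set e; e'] :|: (E :\: [set e; e']) by setb.
have := connected_rk2 M3 sE sU; rewrite cardsDS // cards2 ne /=.
have -> : 1 < #|E| - 2 by rlia.
move=> /(_ isT isT); have := rk_card M [set e; e'];
  have := rkS M (subsetDl E [set e; e']).
by rewrite cards2 ne; rlia.
Qed.

Lemma rk_setD1 e : e \in E -> r (E :\ e) = r E.
Proof.
move=> eE; have sE : [set e] \subset E by rewrite sub1set.
have sU : E \subset [set e] :|: (E :\ e) by setb.
have := connected_rk1 M3 sE sU;
  rewrite cardsDS // cards1 subn_gt0 (leq_trans _ M4) // => /(_ isT isT).
by have := rk_card M [set e]; have := rkS M (subD1set E e); rewrite cards1; rlia.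
Qed.

(* [(X, x, E - X - x)] is a vertical 3-partition. *)
Definition vertical x X :=
  let Y := E :\: (x |: X) in
  [&& [&& x \in E, X \subset E & x \notin X], r (x |: X) <= r X, r (x |: Y) <= r Y,
      r X + r Y <= r E + 2 & (3 <= r X) && (3 <= r Y)].

Lemma verticalP x X : reflect
  (let Y := E :\: (x |: X) in
   [/\ [/\ x \in E, X \subset E & x \notin X], r (x |: X) <= r X, r (x |: Y) <= r Y,
      r X + r Y <= r E + 2 & 3 <= r X /\ 3 <= r Y]) (vertical x X).
Proof.
apply: (iffP idP) => /=; first by case/and5P=> /and3P[a b c] h1 h2 h3 /andP[h4 h5].
by case=> -[a b c] h1 h2 h3 [h4 h5]; apply/and5P; split=> //; [apply/and3P|apply/andP].
Qed.

Lemma vertical_sym x X : vertical x X -> vertical x (E :\: (x |: X)).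
Proof.
case/verticalP=> /= -[xE sX xX] h1 h2 h3 [h4 h5]; apply/verticalP => /=.
have -> : E :\: (x |: E :\: (x |: X)) = X by setb.
by rewrite addnC; split=> //; split=> //; [setb | rewrite !inE eqxx].
Qed.

(** Take a separation of M / x that is vertical. Since M is 3-connected, adding x to one side alone
    must not give a 2-separation of M, which forces both sides to span x and k to be 2. Rank two in
    M / x is then rank three in M. *)
Lemma si_contract_connected x : x \in E -> (forall X, ~~ vertical x X) ->
  connected 3 (si (contract M [set x])).
Proof.
move=> xE nv; apply: si_connected => X k /= sX k3; rewrite !rk_contract rk_set1 //.
have sXE : X \subset E by setb.
have xX : x \notin X by apply/negP => /(subsetP sX); rewrite !inE eqxx.
set Y := E :\ x :\: X.
have -> : E :\ x :|: [set x] = E by rewrite setUC setD1K.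
rewrite !(setUC _ [set x]) => hX hY; rewrite leqNgt; apply/negP => lt.
have YE : Y = E :\: (x |: X) by rewrite /Y; setb.
have sYE : Y \subset E by rewrite /Y; setb.
have EX : E :\: X = x |: Y by rewrite /Y; setb.
have EY : E :\: Y = x |: X by rewrite /Y; setb.
have cX : #|x |: X| = #|X|.+1 by rewrite cardsU1 xX.
have cY : #|x |: Y| = #|Y|.+1 by rewrite cardsU1 /Y !inE eqxx andbF.
have sU1 : E \subset X :|: (x |: Y) by rewrite -EX; setb.
have sU2 : E \subset Y :|: (x |: X) by rewrite -EY; setb.
have := connected_rk2 M3 sXE sU1; have := connected_rk2 M3 sYE sU2.
rewrite EX EY cX cY !ltnS.
have cE : #|E| = #|X| + #|Y| + 1 by have := cardsD E X;
  rewrite (setIidPr sXE) EX cY; have := subset_leq_card sXE; rlia.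
have := rk_card M (x |: X); have := rk_card M (x |: Y); rewrite cX cY => rY rX.
have := rkS M (subsetUr [set x] X); have := rkS M (subsetUr [set x] Y) => mY mX.
have [cX2|cX2] := leqP 2 #|X|; have [cY2|cY2] := leqP 2 #|Y|; last by rlia.
all: rewrite ?(ltnW cX2) ?(ltnW cY2) ?cX2 ?cY2.
- move=> /(_ isT isT) c1 /(_ isT isT) c2.
  have k2 : k = 2 by rlia.
  have /negP[] := nv X; apply/verticalP; rewrite /= -YE; split=> //; rlia.
- by move=> _ /(_ isT); rlia.
- by move=> /(_ isT); rlia.
Qed.

(** By 3-connectivity the rank of X cannot drop when e leaves it, so X - e still spans x. *)
Lemma vertical_move x X e : vertical x X -> e \in X ->
  r (e |: E :\: (x |: X)) <= r (E :\: (x |: X)) -> vertical x (X :\ e).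
Proof.
case/verticalP=> /=; set Y := E :\: _ => -[xE sX xX] h1 h2 h3 [h4 h5] eX h6.
have Y'E : E :\: (x |: X :\ e) = e |: Y by rewrite /Y; setb.
have sXe : X :\ e \subset E by rewrite /Y; setb.
have h7 : r (x |: (e |: Y)) <= r (e |: Y) by apply: rk_cl_mono h2; exact: subsetUr.
have h8 : r (x |: X :\ e) <= r X by apply: leq_trans h1; apply: rkS; setb.
have c1 : 1 < #|X :\ e| by have := cardsD1 e X; have := rk_card M X; rewrite eX; rlia.
have c2 : 1 < #|E :\: (X :\ e)|.
  have sYD : Y \subset E :\: (X :\ e) by rewrite /Y; setb.
  by have := subset_leq_card sYD; have := rk_card M Y; rlia.
have sU : E \subset X :\ e :|: (x |: (e |: Y)) by rewrite /Y; setb.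
have := connected_rk2 M3 sXe sU c1 c2; have := rkS M (subD1set X e).
have := rkS M (subsetUr [set e] Y).
move=> *; apply/verticalP; rewrite /= Y'E; split;
  first by rewrite sXe !inE negb_and xX orbT.
all: try split; rlia.
Qed.

(** Submodularity bounds the connectivity of s + (X & R) and of {x, s} + (X & S), where & is
    intersection; each is a line or gives a vertical 3-partition for s inside X. The bounds need two
    elements in the complement, so the cases where Y misses S or has at most one element in R are
    treated apart. *)
Lemma vertical_uncross x X s S : vertical x X ->
  (forall e, e \in X -> r (E :\: (x |: X)) < r (e |: E :\: (x |: X))) ->
  s \in X -> vertical s S -> x \in S -> let R := E :\: (s |: S) in
  [\/ exists2 X', vertical s X' & X' \proper X,
      #|R| < #|X| /\ #|R :\: X| <= 1
    | r (s |: X :&: R) <= 2 /\ r ([set x; s] :|: X :&: S) <= 2].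
Proof.
case/verticalP=> /=; set Y := E :\: (x |: X) =>
  -[xE sX xX] clxX clxY h3 [h4 h5] indep sXin.
move=> vS xS; case/verticalP: (vS) => /=;
  set R := E :\: (s |: S) => -[sE sSE sS] clsS clsR h3' [h4' h5'].
have Ys := indep s sXin.
(* If Y misses S, then R contains Y and so spans x; moving x from S to R leaves a set properly
   inside X. *)
have [YS0|[y /setIP[yY yS]]] := set_0Vmem (Y :&: S).
  have sYR : Y \subset R.
    apply/subsetP=> z zY; have : z \in Y :&: S = false by rewrite YS0 inE.
    rewrite inE zY /= => zS; move: zY; rewrite !inE zS orbF => /andP[];
      rewrite negb_or => /andP[_ zX] ->.
    by rewrite andbT; apply: contra zX => /eqP->.
  constructor 1; exists (S :\ x); first by apply: vertical_move => //;
    apply: rk_cl_mono clxY.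
  apply/properP; split; last by exists s; rewrite // !inE negb_and sS orbT.
  apply/subsetP=> z; rewrite !inE => /andP[zx zS].
  have : z \in Y :&: S = false by rewrite YS0 inE.
  by rewrite !inE zS (subsetP sSE _ zS) (negPf zx) /= !andbT => /negbFE.
have cXR : 1 < #|X :|: R| by apply: leq_trans (subset_leq_card (subsetUl X R));
  have := rk_card M X; rlia.
have v : r (s |: X :&: R) + r (x |: Y :|: S) <= r E + 2.
  uncross M (X :|: R) (s |: X :&: R) (s |: R) X.
  uncross M (x |: Y :|: S) ((x |: Y) :&: S) (x |: Y) S.
  have sA : X :|: R \subset E by rewrite /R; setb.
  have sU : E \subset X :|: R :|: (x |: Y) :&: S by rewrite /R /Y; setb.
  have cD : 1 < #|E :\: (X :|: R)|.
    move: yY; rewrite !inE negb_or => /andP[/andP[yx yX] yE].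
    apply/card_gt1P; exists x, y; split; last by rewrite eq_sym.
      by rewrite !inE xE xS (negPf xX) orbT.
    by rewrite !inE yE yS (negPf yX) orbT.
  have := connected_rk2 M3 sA sU cXR cD; rlia.
have clsYS : r (s |: (x |: Y :|: S)) <= r (x |: Y :|: S).
  by apply: rk_cl_mono clsS; exact: subsetUr.
have v1 : 1 < #|X :&: R| -> r (s |: X :&: R) <= r (X :&: R).
  move=> c1; have sA : X :&: R \subset E by rewrite /R; setb.
  have sU : E \subset X :&: R :|: (s |: (x |: Y :|: S)) by rewrite /R /Y; setb.
  have cD : 1 < #|E :\: (X :&: R)|.
    have sYD : Y \subset E :\: (X :&: R) by rewrite /Y; setb.
    by have := subset_leq_card sYD; have := rk_card M Y; rlia.
  have := connected_rk2 M3 sA sU c1 cD; rlia.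
have [rXR|rXR] := leqP 3 (r (X :&: R)).
  constructor 1; exists (X :&: R); last first.
    by apply/properP; split; [exact: subsetIl | exists s; rewrite // !inE eqxx andbF].
  have c1 : 1 < #|X :&: R| by have := rk_card M (X :&: R); rlia.
  have compE : E :\: (s |: X :&: R) = x |: Y :|: S by rewrite /R /Y; setb.
  have mY : Y \subset x |: Y :|: S by setb.
  have := rkS M mY; have := v1 c1; have := rkS M (subsetUr [set s] (X :&: R)) => *.
  apply/verticalP; rewrite /= compE; split=> //.
  - by split=> //; [rewrite /R; setb | rewrite !inE eqxx andbF].
  - by rlia.
  - by split; rlia.
have P1 : r (s |: X :&: R) <= 2.
  have [c1|c1] := ltnP 1 #|X :&: R|; first by have := v1 c1; rlia.
  by have := rkU1 M s (X :&: R); have := rk_card M (X :&: R); rlia.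
(* Otherwise S lies in Y + x, and s, which S spans, would be in cl(Y). *)
have /set0Pn[a aXS] : X :&: S != set0.
  apply/negP=> /eqP XS0.
  have sSY : S \subset x |: Y.
    apply/subsetP=> z zS; have : z \in X :&: S = false by rewrite XS0 inE.
    by rewrite !inE zS andbT (subsetP sSE _ zS) => ->; case: eqP.
  have := rk_cl_mono sSY clsS; have := rkS M (setUS [set s] (subsetUr [set x] Y)).
  by rlia.
(* Both s and a lie in X but not in R, while R has at most one element outside X; hence |R| <
   |X|. *)
have [cYR|cYR] := leqP #|Y :&: R| 1.
  constructor 2.
  have sRX : R :\: X \subset Y :&: R by rewrite /R /Y; setb.
  have cRX := leq_trans (subset_leq_card sRX) cYR; split=> //.
  rewrite -(cardsID X R) -(cardsID R X) setIC.
  suff : 1 < #|X :\: R| by rlia.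
  move: aXS; rewrite inE => /andP[aX aS].
  apply/card_gt1P; exists s, a; split; rewrite ?inE ?eqxx ?aS ?sXin ?aX ?orbT //=.
  by apply: contra sS => /eqP->.
have [P2|P2] := leqP (r ([set x; s] :|: X :&: S)) 2; first by constructor 3.
have v2 : r ([set x; s] :|: X :&: S) + r (Y :|: R) <= r E + 2.
  uncross M (X :|: S) ([set x; s] :|: X :&: S) (x |: X) (s |: S).
  uncross M (Y :|: R) (Y :&: R) Y R.
  have sA : X :|: S \subset E by setb.
  have sU : E \subset X :|: S :|: Y :&: R by rewrite /R /Y; setb.
  have cXS : 1 < #|X :|: S| by apply: leq_trans (subset_leq_card (subsetUl X S));
    have := rk_card M X; rlia.
  have cD : 1 < #|E :\: (X :|: S)|.
    have sD : Y :&: R \subset E :\: (X :|: S) by rewrite /R /Y; setb.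
    by have := subset_leq_card sD; rlia.
  have := connected_rk2 M3 sA sU cXS cD; rlia.
have clYR : r ([set x; s] :|: (Y :|: R)) <= r (Y :|: R).
  apply: rk_cl => z; rewrite !inE => /orP[/eqP->|/eqP->].
    by apply: rk_cl_mono clxY; exact: subsetUl.
  by apply: rk_cl_mono clsR; exact: subsetUr.
(* If a were the only element of X & S, everything but a would lie in {x, s} + Y + R, whose rank is
   below r(E), and a would be a coloop. *)
have [cXS|cXS] := ltnP 1 #|X :&: S|; last first.
  have e1 : X :&: S = [set a].
    by apply/esym/eqP; rewrite eqEcard sub1set aXS cards1.
  have aE : a \in E by move: aXS; rewrite inE => /andP[/(subsetP sX)].
  have sEa : E :\ a \subset [set x; s] :|: (Y :|: R) by rewrite -e1 /R /Y; setb.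
  by exfalso; have := rkS M sEa; rewrite rk_setD1 //; rlia.
have v3 : r ([set x; s] :|: X :&: S) <= r (X :&: S).
  have sA : X :&: S \subset E by setb.
  have sU : E \subset X :&: S :|: ([set x; s] :|: (Y :|: R)) by rewrite /R /Y; setb.
  have cD : 1 < #|E :\: (X :&: S)|.
    have sYD : Y \subset E :\: (X :&: S) by rewrite /Y; setb.
    by have := subset_leq_card sYD; have := rk_card M Y; rlia.
  have := connected_rk2 M3 sA sU cXS cD; rlia.
have [rXS|rXS] := leqP 3 (r (X :&: S)); last by exfalso; rlia.
constructor 1; exists (X :&: S); last first.
  by apply/properP; split; [exact: subsetIl | exists s;
    rewrite // !inE (negPf sS) andbF].
have compE : E :\: (s |: X :&: S) = x |: (Y :|: R) by rewrite /R /Y; setb.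
have m1 : s |: X :&: S \subset [set x; s] :|: X :&: S by setb.
have m2 : x |: (Y :|: R) \subset [set x; s] :|: (Y :|: R) by setb.
have m3 : X :&: S \subset [set x; s] :|: X :&: S by setb.
have m4 : Y \subset x |: (Y :|: R) by setb.
have clsYR : r (s |: (x |: (Y :|: R))) <= r (x |: (Y :|: R)).
  by apply: rk_cl_mono clsR; setb.
have := rkS M m1; have := rkS M m2; have := rkS M m3; have := rkS M m4 => *.
apply/verticalP; rewrite /= compE; split=> //.
- by split=> //; [setb | rewrite !inE (negPf sS) andbF].
- by rlia.
- by rlia.
- by split; rlia.
Qed.

(* Crosses the 2-separations of M / c and of M \ c. *)
Lemma bixby_cross c P A (Q := E :\: (c |: P)) (B := E :\ c :\: A) :
  vertical c P -> A \subset E :\ c -> r A + r B <= r E + 1 ->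
  (#|P :&: A| <= 1) || (#|Q :&: B| <= 1).
Proof.
case/verticalP; rewrite -/Q => -[cE sP cP] clP clQ h [hP hQ] sA hAB.
apply: contraT; rewrite negb_or -!ltnNge => /andP[c1 c2].
have sPA : P :&: A \subset E by setb.
have sQB : Q :&: B \subset E by rewrite /Q; setb.
have sU1 : E \subset P :&: A :|: (c |: Q :|: B) by rewrite /Q /B; setb.
have sU2 : E \subset Q :&: B :|: (c |: P :|: A) by rewrite /Q /B; setb.
have d1 : 1 < #|E :\: (P :&: A)|.
  have sD : Q \subset E :\: (P :&: A) by rewrite /Q; setb.
  by apply: leq_trans (subset_leq_card sD); have := rk_card M Q; rlia.
have d2 : 1 < #|E :\: (Q :&: B)|.
  have sD : P \subset E :\: (Q :&: B) by rewrite /Q; setb.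
  by apply: leq_trans (subset_leq_card sD); have := rk_card M P; rlia.
uncross M (c |: P :|: A) (P :&: A) (c |: P) A.
uncross M (c |: Q :|: B) (Q :&: B) (c |: Q) B.
have := connected_rk2 M3 sPA sU1 c1 d1; have := connected_rk2 M3 sQB sU2 c2 d2.
rlia.
Qed.

(** Crossing with (A, B) and with (B, A) gives two intersections with at most one element each.
    Whichever they are, together they make up one of P, Q, A, B, all of which have at least three
    elements. *)
Lemma bixby c P A (B := E :\ c :\: A) : vertical c P -> A \subset E :\ c ->
  2 < #|A| -> 2 < #|B| -> r E + 2 <= r A + r B.
Proof.
move=> vP sA cA cB; rewrite leqNgt; apply/negP => lt.
have hAB : r A + r B <= r E + 1 by rlia.
have sB : B \subset E :\ c by rewrite /B; setb.
have BB : E :\ c :\: B = A by rewrite /B; setb.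
have hBA : r B + r (E :\ c :\: B) <= r E + 1 by rewrite BB; rlia.
have := bixby_cross vP sA hAB; have := bixby_cross vP sB hBA.
rewrite BB -/B; case/verticalP: vP; set Q := E :\: _ => -[cE sP cP] _ _ _ [hP hQ].
have EP : (P :&: A) :|: (P :&: B) = P by rewrite /B; setb.
have EQ : (Q :&: A) :|: (Q :&: B) = Q by rewrite /B /Q; setb.
have EA : (P :&: A) :|: (Q :&: A) = A by rewrite /Q; setb.
have EB : (P :&: B) :|: (Q :&: B) = B by rewrite /Q /B; setb.
have := rk_card M P; have := rk_card M Q.
have := cardsUI (P :&: A) (P :&: B); have := cardsUI (Q :&: A) (Q :&: B).
have := cardsUI (P :&: A) (Q :&: A); have := cardsUI (P :&: B) (Q :&: B).
rewrite EP EQ EA EB => h1 h2 h3 h4 h5 h6 /orP[h7|h7] /orP[h8|h8]; rlia.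
Qed.

End Vertical.

(** * Segments *)

Section Segment.
Variables (T : finType) (M : matroid T).
Implicit Types (X Y Z S R P Q A B : {set T}) (x y e s c b : T).
Notation E := (ground M).
Notation r := (rk M).
Hypotheses (M3 : connected 3 M) (M4 : 4 <= #|ground M|).

Section DeleteSegment.
Variables (x s c : T) (Z : {set T}).
Hypotheses (xE : x \in E) (sE : s \in E) (cE : c \in E) (sZ : Z \subset E).
Hypotheses (xs : x != s) (sc : s != c) (xc : x != c).
Hypotheses (xZ : x \notin Z) (sZ' : s \notin Z) (cZ : c \notin Z).
Let L := [set x; s; c] :|: Z.
Hypothesis rL : r L <= 2.

Lemma segment_sub : L \subset E.
Proof. by rewrite !subUset !sub1set xE sE cE. Qed.

Lemma segment_span p q A : p \in L -> q \in L -> p != q -> p \in A -> q \in A ->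
  r (L :|: A) <= r A.
Proof.
move=> pL qL pq pA qA; have sLE := segment_sub.
apply: (@rk_cl_mono _ _ [set p; q]); first by rewrite subUset !sub1set pA.
rewrite rk_set2 ?(subsetP sLE) //; apply: leq_trans rL; apply: rkS.
by rewrite subUset subxx subUset !sub1set pL.
Qed.

(** Two of x, s, c fall on the same side of a separation, and their line spans [Z], so [Z] can be
    put back on that side. *)
Lemma delete_segment_connected : connected 3 (delete M Z).
Proof.
have key p q A k : A \subset E :\: Z -> p \in L :\: Z -> q \in L :\: Z -> p != q ->
    p \in A -> q \in A -> 0 < k < 3 -> k <= #|A| -> k <= #|E :\: Z :\: A| ->
    r (E :\: Z) + k <= r A + r (E :\: Z :\: A).
  move=> sA; rewrite !in_setD => /andP[_ pL] /andP[_ qL] pq pA qA k3 cA cB.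
  have h := segment_span pL qL pq pA qA.
  have hZ : r (A :|: Z) <= r A by apply: leq_trans h; rewrite setUC;
    apply/rkS/setSU/subsetUr.
  rewrite leqNgt; apply/negP => lt; apply: (M3 k3); exists (A :|: Z).
  have sAZ : A :|: Z \subset E by setb.
  have e1 : E :\: (A :|: Z) = E :\: Z :\: A by setb.
  have lA : #|A| <= #|A :|: Z| by apply: subset_leq_card; exact: subsetUl.
  have := rkS M (subsetDl E Z) => mE.
  apply/and4P; split; rewrite ?e1 //; last by rlia.
  by rewrite /connectivity e1 -!rk_rank //; [rlia | setb].
move=> k k3 [A /and4P[/= sA]]; rewrite /connectivity /= => lt cA cB.
have sB : E :\: Z :\: A \subset E :\: Z by exact: subsetDl.
have BB : E :\: Z :\: (E :\: Z :\: A) = A by setb.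
have : r A + r (E :\: Z :\: A) < r (E :\: Z) + k.
  have s1 : A \subset E by setb.
  have s2 : E :\: Z :\: A \subset E by setb.
  by move: lt; rewrite -!rk_rank ?subsetDl //; rlia.
apply/negP; rewrite -leqNgt.
have xL : x \in L :\: Z by rewrite !inE eqxx xZ.
have sL : s \in L :\: Z by rewrite !inE eqxx sZ' orbT.
have cL : c \in L :\: Z by rewrite !inE eqxx cZ orbT.
have inB z : z \in E -> z \notin Z -> z \notin A -> z \in E :\: Z :\: A.
  by move=> zE zZ zA; rewrite !inE zA zZ.
have keyA p q := @key p q A k sA.
have keyB p q : p \in L :\: Z -> q \in L :\: Z -> p != q ->
    p \in E :\: Z :\: A -> q \in E :\: Z :\: A ->
    r (E :\: Z) + k <= r A + r (E :\: Z :\: A).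
  by move=> pL qL pq pB qB; have := @key p q _ k sB pL qL pq pB qB k3 cB;
    rewrite BB => /(_ cA); rlia.
have [xA|/(inB x xE xZ) xB] := boolP (x \in A);
  have [sA'|/(inB s sE sZ') sB'] := boolP (s \in A);
  have [cA'|/(inB c cE cZ) cB'] := boolP (c \in A).
all: try by [apply: (keyA x s) | apply: (keyA x c) | apply: (keyA s c)].
all: by [apply: (keyB x s) | apply: (keyB x c) | apply: (keyB s c)].
Qed.

(** Let Q be the side of x. As Q spans c, it spans the line through x and c, so all points of [L] in
    P can be moved to Q. Then deleting [Z] does not touch P, and x and s keep [Z] in the span of
    what remains of Q. *)
Lemma vertical_delete_segment P : vertical M c P ->
  exists P', vertical (delete M Z) c P'.
Proof.
move=> vP; wlog xP : P vP / x \notin P.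
  move=> gen; have [xP|] := boolP (x \in P); last exact: gen.
  by apply: gen (vertical_sym vP) _; rewrite !inE xP orbT.
have [n] := ubnP #|P :&: L|; elim: n => // n IH in P vP xP *; rewrite ltnS => lePL.
have cL : c \in L by rewrite !inE eqxx orbT.
have xL : x \in L by rewrite !inE eqxx.
have sLE := segment_sub.
have xc' : c != x by rewrite eq_sym.
have [[cE' sP cP] clP clQ h [hP hQ]] := verticalP _ _ _ vP.
set Q := E :\: (c |: P) in clQ h hQ.
have xQ : x \in Q by rewrite !inE xE (negPf xc) (negPf xP).
have spanQ e : e \in L -> r (e |: Q) <= r Q.
  move=> eL; apply: leq_trans clQ.
  have : r (L :|: (c |: Q)) <= r (c |: Q).
    by apply: segment_span xL cL xc _ _; [apply/setU1P; right | exact: setU11].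
  by apply: leq_trans; apply: rkS;
    rewrite subUset sub1set inE eL /= subsetU // subsetUr orbT.
have [PL0|[e /setIP[eP eL]]] := set_0Vmem (P :&: L); last first.
  apply: (IH (P :\ e)); last 1 first.
  - by apply: leq_trans lePL; rewrite (cardsD1 e (P :&: L)) inE eP eL setIDAC.
  - by apply: vertical_move => //; exact: spanQ.
  - by rewrite !inE negb_and xP orbT.
have dP z : z \in L -> z \notin P.
  by move=> zL; apply/negP=> zP; have := in_set0 z; rewrite -PL0 inE zP zL.
have ZL : Z \subset L by exact: subsetUr.
have PZ : P :\: Z = P by apply/setDidPl; rewrite disjoint_sym disjoints_subset;
  apply/subsetP=> z /(subsetP ZL)/dP; rewrite inE.
have sQ : s \in Q by rewrite !inE sE (negPf sc) (dP s) ?inE ?eqxx ?orbT.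
have span_xs A : x \in A -> s \in A -> A \subset L :|: A :\: Z -> r A <= r (A :\: Z).
  move=> xA sA sub; apply: leq_trans (rkS M sub) _; apply: (@segment_span x s) => //.
  - by rewrite !inE eqxx orbT.
  - by rewrite inE xZ.
  - by rewrite inE sZ'.
have LQ A : A \subset L :|: A :\:
  Z by rewrite -{1}(setID A Z) setSU // subIset // ZL orbT.
have rQ := span_xs _ xQ sQ (LQ Q); have rE := span_xs _ xE sE (LQ E).
have compQ : E :\: Z :\: (c |: P) = Q :\: Z by rewrite /Q setDDl setUC -setDDl.
have nP := rkS M (subsetDl (c |: P) Z).
have nQ : r (c |: Q :\: Z) <= r (c |: Q) by apply/rkS/setUS/subsetDl.
have DD (A : {set T}) : A :\: Z :\: Z = A :\: Z by rewrite setDDl setUid.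
have Zc (A : {set T}) : (c |: A) :\: Z = c |: A :\: Z by setb.
exists P; apply/verticalP; rewrite /= compQ !rk_delete Zc !DD PZ; split.
- by split; rewrite // ?inE ?cZ // subsetD sP disjoint_sym disjoints_subset;
    apply/subsetP=> z /(subsetP ZL)/dP; rewrite inE.
- exact: clP.
- by rewrite Zc DD; rlia.
- by have := rkS M (subsetDl Q Z); rlia.
- by split; rlia.
Qed.

(* In the restriction to F0, the pair {s, b} is in series: a 2-separation of
   co(si(M / s)) lifts to one of F0 with s added to the side of b. *)
Section CoSi.
Variable b : T.
Let F0 := E :\: (c |: Z).
Let W := F0 :\ s :\ b.
Hypotheses (bF : b \in F0) (bs : b != s) (sW : r W < r (s |: W)).
Hypothesis nosep : forall A, A \subset F0 -> 2 < #|A| -> 2 < #|F0 :\: A| ->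
  r E + 2 <= r A + r (F0 :\: A).

Let K := contract M [set s].

Let rkK X : rk K X + 1 = r (s |: X).
Proof.
rewrite rk_contract rk_set1 // setUC subnK //.
by rewrite -(rk_set1 M3 M4 sE) rkS // subsetUl.
Qed.

Let nonloopK e : (e \in nonloops K) = (e \in E) && (e != s).
Proof.
rewrite nonloopE !inE; case es: (e == s); rewrite ?andbF //= andbT.
case eE: (e \in E) => //=.
have se : s != e by rewrite eq_sym es.
by have := rkK [set e]; rewrite (rk_set2 M3 M4 sE eE se) => h; apply/eqP; rlia.
Qed.

Let lift X := [set e in F0 :\ s | simple_rep K e \in X].

Let liftE X e : (e \in lift X) = [&& e != s, e \in F0 & simple_rep K e \in X].
Proof. by rewrite in_set in_setD1 -andbA. Qed.

Let F0E e : e \in F0 -> e \in E.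
Proof. by rewrite inE => /andP[]. Qed.

Let rk_lift X : r (s |: lift X) <= r (s |: X).
Proof.
rewrite -!rkK leq_add2r; apply: rk_cl_le => e; rewrite liftE => /and3P[es eF eX].
by apply: simples_rk_cl => //; rewrite !inE es F0E.
Qed.

(** A representative outside [F0] lies in L - s, which is a single parallel class of M / s; so X
    contains at most one, and x, which stays in [F0], makes up for it. *)
Let card_lift X : X \subset simples K -> #|X| <= #|lift X|.
Proof.
move=> sX; have XK e : e \in X -> e \in E /\ e != s.
  by move=> /(subsetP sX)/(subsetP (@simples_nonloops _ K));
    rewrite nonloopK => /andP[].
have XF e : e \in X -> e \in F0 -> e \in lift X.
  by move=> eX eF; rewrite liftE eF (XK e eX).2 simple_rep_id // (subsetP sX).
have [/subsetP sXF|/subsetPn[e eX eF]] := boolP (X \subset F0).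
  by apply: subset_leq_card; apply/subsetP=> e eX; apply: XF (sXF _ eX).
have inL z : z \in E -> z \notin F0 -> z \in L.
  by move=> zE; rewrite !inE zE andbT negbK => /orP[->|->]; rewrite ?orbT.
have parL y z : y \in L -> z \in L -> rk K [set y; z] <= 1.
  move=> yL zL; have := rkK [set y; z].
  have : r (s |: [set y; z]) <= 2 by apply: leq_trans rL; apply: rkS;
    rewrite !subUset !sub1set yL zL !inE eqxx orbT.
  by rlia.
have xL : x \in L by rewrite !inE eqxx.
have [eE es] := XK e eX; have eL := inL e eE eF.
have eS := subsetP sX _ eX.
have simL z : z \in simples K -> z \in L -> z = e.
  by move=> zS zL; apply: (@simples_inj _ K) (parL _ _ _ _).
have xN : x \in nonloops K by rewrite nonloopK xE.
have repx : simple_rep K x = e.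
  have [tS rt] := simple_repP xN; apply: (@simples_inj _ K) => //.
  have rx := rk_nonloop xN; have := parL _ _ xL eL.
  have := @rk_uncross _ K [set simple_rep K x; e] [set x] [set x;
    simple_rep K x] [set x; e].
  rewrite sub1set !inE eqxx => h rxe.
  have : rk K [set simple_rep K x; e] + rk K [set x] <= rk K [set x;
    simple_rep K x] + rk K [set x; e].
    by apply: h => //; rewrite subUset !sub1set !inE !eqxx !orbT.
  by rlia.
have xF : x \in F0 by rewrite !inE xE (negPf xc) (negPf xZ).
have -> : #|X| = #|x |: X :\ e|.
  rewrite cardsU1 (cardsD1 e X) eX !inE; congr (nat_of_bool _ + _); apply/esym.
  by apply/negP=> /andP[xe xX]; rewrite (simL x (subsetP sX _ xX) xL) eqxx in xe.
apply: subset_leq_card; rewrite subUset sub1set liftE xs xF repx eX /=.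
apply/subsetP=> z; rewrite in_setD1 => /andP[ze zX]; apply: XF => //.
by apply: contraT => /(inL z (XK z zX).1)/(simL z (subsetP sX _ zX)) zE;
  rewrite zE eqxx in ze.
Qed.

(** Only the side of b receives s. The other side lies in [W], which does not span s, so adding s to
    it raises its rank; this turns the 2 of [nosep] into 3. *)
Let no_lift_sep X : X \subset simples K -> 2 < #|X| -> 2 < #|simples K :\: X| ->
  b \in lift X -> r E + 3 <= r (s |: X) + r (s |: (simples K :\: X)).
Proof.
move=> sX cX cX' bX.
have D : F0 :\: (s |: lift X) = lift (simples K :\: X).
  apply/setP=> z; rewrite in_setD in_setU1 !liftE in_setD negb_or.
  case zs: (z == s) => //=; case zF: (z \in F0); rewrite ?andbF //= !andbT.
  by rewrite (simple_repP _).1 ?andbT // nonloopK zs F0E.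
have sB : lift (simples K :\: X) \subset W.
  rewrite -D; apply/subsetP=> z;
    rewrite in_setD in_setU1 negb_or => /andP[/andP[zs zX] zF].
  rewrite 2!in_setD1 zs zF !andbT; apply: contra zX => /eqP->; exact: bX.
have sF : s |: lift X \subset F0.
  rewrite subUset sub1set; apply/andP; split.
    by rewrite !inE sE (negPf sc) (negPf sZ').
  by apply/subsetP=> z; rewrite liftE => /and3P[].
have := nosep sF; rewrite D.
have -> : 2 < #|s |: lift X|.
  by apply: leq_trans cX _; apply: leq_trans (card_lift sX) _;
    apply/subset_leq_card/subsetUr.
have -> : 2 < #|lift (simples K :\: X)|.
  by apply: leq_trans cX' _; apply: card_lift; exact: subsetDl.
move=> /(_ isT isT); have := rk_lift X; have := rk_lift (simples K :\: X).
have : r (lift (simples K :\: X)) < r (s |: lift (simples K :\: X)).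
  by rewrite ltnNge; apply/negP=> /(rk_cl_mono sB); rlia.
by rlia.
Qed.

Lemma co_si_connected : connected 3 (co (si K)).
Proof.
apply/connected_dual/si_connected => X k.
rewrite -[ground (dual (si K))]/(ground (si K)) ground_si => sX k3 k1 k2.
have sX' : simples K :\: X \subset simples K by exact: subsetDl.
have XX : simples K :\: (simples K :\: X) = X by rewrite setDDr setDv set0U;
  apply/setIidPr.
rewrite leqNgt; apply/negP => lt.
have := rk_dual (si K) X; have := rk_dual (si K) (simples K :\: X);
  have := rk_dual (si K) (simples K).
rewrite ground_si XX setIid setDv rk0 (setIidPl sX) (setIidPl sX') (rk_si sX)
  (rk_si sX') (rk_si (subxx _)).
have cT : #|simples K| = #|X| + #|simples K :\: X|.
  by have := cardsID X (simples K); rewrite (setIidPr sX).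
rewrite cT => d0 d1 d2.
(* Both sides have dual rank at least k and connectivity below k, so neither spans the dual. Hence
   both are dependent in si(K), where dependent sets have at least three elements. *)
have g1 : rk K X < #|X| by rlia.
have g2 : rk K (simples K :\: X) < #|simples K :\: X| by rlia.
have c1 := simples_card sX g1; have c2 := simples_card sX' g2.
have rT : rk K (simples K) + 1 = r E by rewrite rk_simples rkK /= setD1K.
have ub : r (s |: X) + r (s |: (simples K :\: X)) <= r E + 2 by rewrite -!rkK; rlia.
have repb : simple_rep K b \in simples K by apply: (simple_repP _).1;
  rewrite nonloopK bs F0E.
have [bX|bX] := boolP (simple_rep K b \in X).
  by have := no_lift_sep sX c1 c2; rewrite liftE bs bF bX => /(_ isT); rlia.
have := no_lift_sep sX' c2; rewrite XX liftE bs bF in_setD bX repb => /(_ c1 isT); rlia.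
Qed.

End CoSi.
End DeleteSegment.
End Segment.

(** * The main argument *)

Section Circuits.
Variables (T : finType) (M : matroid T).
Implicit Types (B C X : {set T}) (e : T).
Notation E := (ground M).
Notation r := (rk M).

Lemma dependent_dual X : dependent (dual M) X = (X \subset E) && (r (E :\: X) < r E).
Proof.
rewrite /dependent /= -[ground (dual M)]/E; case sX: (X \subset E) => //=.
rewrite -[dual_rank M X]/(rank (dual M) X) -rk_rank //.
by have := rk_dual M X; rewrite (setIidPl sX) => h; apply/idP/idP; rlia.
Qed.

Lemma cocircuitP C : reflect
  [/\ C \subset E, r (E :\: C) < r E & forall e, e \in C -> r E <= r (e |: E :\: C)]
  (cocircuit M C).
Proof.
apply: (iffP minsetP) => [[dC minC]|[sC lt span]].
  move: dC; rewrite -/(dependent (dual M) C) dependent_dual => /andP[sC lt];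
    split=> // e eC.
  rewrite leqNgt; apply/negP => lt'.
  have eE : e |: E :\: C = E :\: (C :\ e) by have eIE := subsetP sC _ eC; setb.
  have dCe : dependent (dual M) (C :\ e).
    by rewrite dependent_dual -eE lt' (subset_trans (subD1set _ _)).
  by have := minC _ dCe (subD1set _ _) => /setP/(_ e); rewrite !inE eqxx eC.
rewrite -/(dependent (dual M) C) dependent_dual sC lt; split=> // B.
rewrite -/(dependent (dual M) B) dependent_dual => /andP[sB ltB] BC.
apply/eqP; rewrite eqEsubset BC; apply: contraLR ltB => /subsetPn[e eC eB].
rewrite -leqNgt; apply: leq_trans (span e eC) _; apply: rkS.
by rewrite subUset sub1set inE eB (subsetP sC) // setDS.
Qed.

Lemma triangle_circuit x y z : connected 3 M -> 4 <= #|E| ->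
  [set x; y; z] \subset E -> x != y -> y != z -> x != z ->
  r [set x; y; z] <= 2 -> circuit M [set x; y; z].
Proof.
move=> M3 M4 sE xy yz xz le2.
have c3 : #|[set x; y; z]| = 3.
  by rewrite setUC cardsU1 cards2 xy !inE negb_or eq_sym xz eq_sym yz.
apply/minsetP; split=> [|B]; first by apply/andP; split; rewrite -?rk_rank // c3 ltnS.
case/andP=> sB; rewrite -rk_rank // => lt sBC.
apply/eqP; rewrite eqEcard sBC c3 leqNgt; apply: contraL lt => c2; rewrite -leqNgt.
have [c1|c1] := leqP #|B| 1; last first.
  have /card_gt1P[u [v [uB vB uv]]] := c1.
  have := rk_set2 M3 M4 (subsetP sB _ uB) (subsetP sB _ vB) uv.
  have suv : [set u; v] \subset B by rewrite subUset !sub1set uB.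
  by have := rkS M suv; rlia.
have [->|[u uB]] := set_0Vmem B; first by rewrite cards0.
have := rk_set1 M3 M4 (subsetP sB _ uB).
have su : [set u] \subset B by rewrite sub1set.
by have := rkS M su; rlia.
Qed.

End Circuits.

(** * The minimal vertical 3-partition *)

Section Main.
Variables (T T' : finType) (M : matroid T) (N : matroid T') (Cs : {set T}).
Implicit Types (X Y Z S R P Q A B : {set T}) (x y e s c b : T).
Hypotheses (M3 : connected 3 M) (N3 : connected 3 N) (N4 : 4 <= #|ground N|)
  (M4 : 4 <= #|ground M|) (cocCs : cocircuit M Cs).
Notation E := (ground M).
Notation r := (rk M).

Definition conclusion :=
  [\/ exists x : T,
        [/\ x \in Cs, connected 3 (si (contract M [set x]))
          & has_minor (si (contract M [set x])) N],
      exists x : T,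
        [/\ x \in Cs, connected 3 (co (si (contract M [set x])))
          & has_minor (co (si (contract M [set x]))) N]
    | exists x1 x2 x3 x4 : T,
        [set x1; x2; x3; x4] \subset ground M /\
        [/\ circuit M [set x1; x2; x3],
            cocircuit M [set x2; x3; x4],
            x1 \in Cs /\ x3 \in Cs,
            connected 3 (si (contract M [set x2]))
          & has_minor (si (contract M [set x2])) N]].

Lemma has_minor_si_contract (C F : {set T}) (f : T -> T') x : x \in C ->
  minor_map M N C F f ->
  has_minor (si (contract M [set x])) N.
Proof.
by move=> xC /(minor_map_contracted xC) /minor_map_has_minor; exact: has_minor_si.
Qed.

(** Otherwise the hyperplane E - C* contains u and v, hence the whole line and s with it. *)
Lemma line_meets_cocircuit (L : {set T}) s u v : r L <= 2 -> L \subset E ->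
  s \in L -> s \in Cs -> u \in L -> v \in L -> u != v -> (u \in Cs) || (v \in Cs).
Proof.
move=> rL sL sIL sC uL vL uv; apply: contraT; rewrite negb_or => /andP[uC vC].
have [CE lt span] := cocircuitP _ _ cocCs.
have r2 := rk_set2 M3 M4 (subsetP sL _ uL) (subsetP sL _ vL) uv.
have suv : [set u; v] \subset E :\: Cs.
  by rewrite subUset !sub1set !inE uC vC !(subsetP sL).
have h : r (s |: [set u; v]) <= r [set u; v].
  by rewrite r2; apply: leq_trans rL; apply: rkS; rewrite !subUset !sub1set sIL uL vL.
by have := rk_cl_mono suv h; have := span s sC; rlia.
Qed.

Section Step.
Variables (x : T) (X : {set T}).
Hypotheses (vX : vertical M x X) (xC : x \in Cs).
Hypothesis IH : forall x' X' (C F : {set T}) (f : T -> T'), #|X'| < #|X| ->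
  vertical M x' X' -> x' \in Cs ->
  minor_map M N C F f -> x' \in C -> #|F :&: X'| <= 1 -> conclusion.
Let Y := E :\: (x |: X).
Hypothesis indep : forall e, e \in X -> r Y < r (e |: Y).
Variables (C0 F0 : {set T}) (f0 : T -> T').
Hypotheses (m0 : minor_map M N C0 F0 f0) (xC0 : x \in C0) (F0X : #|F0 :&: X| <= 1).

Let xE : x \in E. Proof. by have [[]] := verticalP _ _ _ vX. Qed.
Let sX : X \subset E. Proof. by have [[]] := verticalP _ _ _ vX. Qed.
Let xX : x \notin X. Proof. by have [[]] := verticalP _ _ _ vX. Qed.
Let clX : r (x |: X) <= r X. Proof. by have [] := verticalP _ _ _ vX. Qed.
Let clY : r (x |: Y) <= r Y. Proof. by have [] := verticalP _ _ _ vX. Qed.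
Let sepX : r X + r Y <= r E + 2. Proof. by have [] := verticalP _ _ _ vX. Qed.
Let rX3 : 3 <= r X. Proof. by have [_ _ _ _ []] := verticalP _ _ _ vX. Qed.
Let rY3 : 3 <= r Y. Proof. by have [_ _ _ _ []] := verticalP _ _ _ vX. Qed.

(** (X, Y) is an exact 2-separation of M / x, and s is not parallel to its basepoint because s is
    outside cl(Y). *)
Lemma contractible s : s \in X ->
  exists C F f, [/\ minor_map M N C F f, s \in C & #|F :&: X| <= 1].
Proof.
move=> sIX; have sYE : Y \subset E by exact: subsetDl.
have XY : X :|: Y = ground (contract M [set x]) by rewrite /Y /=; setb.
have dXY : Y \subset ~: X by rewrite /Y; setb.
have rx := rk_set1 M3 M4 xE.
have sU : E \subset X :|: (x |: Y) by rewrite /Y; setb.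
have c1 : 1 < #|X| by have := rk_card M X; rlia.
have c2 : 1 < #|E :\: X|.
  have sYX : Y \subset E :\: X by rewrite /Y; setb.
  by have := subset_leq_card sYX; have := rk_card M Y; rlia.
have conX := connected_rk2 M3 sX sU c1 c2.
have sep : rk (contract M [set x]) X + rk (contract M [set x]) Y =
    rk (contract M [set x]) (ground (contract M [set x])) + 1.
  rewrite !rk_contract rx /= !(setUC _ [set x]) setD1K //.
  have := rkS M (subsetUr [set x] X); have := rkS M (subsetUr [set x] Y); rlia.
have ns : ~~ spans_basepoint (contract M [set x]) Y [set s].
  rewrite /spans_basepoint !rk_contract rx !(setUC _ [set x]) -leqNgt.
  have m1 : s |: Y \subset x |: (s |: Y) by exact: subsetUr.
  have := rk_set2 M3 M4 xE (subsetP sX _ sIX);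
    have -> : x != s by apply: contraNneq xX => ->.
  move=> /(_ isT); have := rkS M m1; have := indep sIX.
  by have := rkS M (subsetUr [set x] Y); rlia.
have [C [F [f [mF sC FX]]]] := contractible_small_side XY dXY sep N3 N4
  (minor_map_contracted xC0 m0) F0X sIX ns.
exists (x |: C), F, f; split=> //; last by rewrite inE sC orbT.
exact: minor_map_contract.
Qed.

Lemma two_lines s : s \in X -> s \in Cs -> conclusion \/
  exists L1 L2 : {set T}, [/\ s \in L1, [set x;
    s] \subset L2, L1 :|: L2 = x |: X, r L1 <= 2 & r L2 <= 2].
Proof.
move=> sIX sCs; have [C [F [f [mF sC FX]]]] := contractible sIX.
have [/existsP[S0 vS0]|] := boolP [exists S, vertical M s S]; last first.
  rewrite negb_exists => /forallP nv; left; constructor 1; exists s; split=> //.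
    by apply: si_contract_connected => //; exact: (subsetP sX).
  exact: has_minor_si_contract mF.
have [S vS xS] : exists2 S, vertical M s S & x \in S.
  have [xS|xS] := boolP (x \in S0); first by exists S0.
  exists (E :\: (s |: S0)); first exact: vertical_sym.
  by rewrite !inE xE (negPf xS) andbT orbF; apply: contraNneq xX => ->.
have [[sE sSE sS] clS clR hSR _] := verticalP _ _ _ vS.
have := vertical_uncross M3 M4 vX indep sIX vS xS;
  set R := E :\: (s |: S) in clR hSR * => -[].
- case=> X' vX' pX'; left; apply: (IH (proper_card pX') vX' sCs mF sC).
  by apply: leq_trans FX; apply/subset_leq_card/setIS/proper_sub.
(* N has at most one element in X and at most one in R - X, so at most two in R. With at most one
   outside R it would have fewer than four elements. *)
- case=> cR cRX; left; apply: (IH cR (vertical_sym vS) sCs mF sC); rewrite -/R.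
  have sF : s \notin F by have [_ _ dCF _ _] := mF; rewrite (disjointFr dCF).
  have FR : F :&: (s |: R) = F :&: R by setb.
  have := minor_map_sides N3 mF N4 (A := s |: R) (B := s |: S) (s := s) sC.
  rewrite !setU11 FR; have -> : E \subset s |: R :|: (s |: S) by rewrite /R; setb.
  have -> : (s |: R) :&: (s |: S) \subset [set s] by rewrite /R; setb.
  rewrite (rk_set1 M3 M4 sE) => /(_ isT isT isT isT).
  have -> : r (s |: R) + r (s |: S) <= r E + 1 + 1 by rlia.
  case/(_ isT)/orP=> // cFD; exfalso.
  have := cardsID (s |: R) F; rewrite FR (minor_map_card mF).
  have sFR : F :&: R \subset (F :&: X) :|: (R :\: X) by setb.
  have := subset_leq_card sFR; have := cardsU (F :&: X) (R :\: X).
  rlia.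
- case=> l1 l2; right; exists (s |: X :&: R), ([set x; s] :|: X :&: S).
  split=> //; [by rewrite !inE eqxx|by exact: subsetUl|rewrite /R; setb].
Qed.

(** Otherwise the hyperplane E - C* contains X, hence also x, which X spans. *)
Lemma cocircuit_meets : exists2 s, s \in X & s \in Cs.
Proof.
apply/exists_inP; apply: contraT => /exists_inPn noX.
have [CE lt span] := cocircuitP _ _ cocCs.
have sXH : X \subset E :\: Cs.
  by apply/subsetP=> z zX; rewrite inE (noX z zX) (subsetP sX).
by have := rk_cl_mono sXH clX; have := span x xC; rlia.
Qed.

Lemma segment_in_X : conclusion \/ exists b s,
  [/\ b \in X, s \in X, s != b, s \in Cs & r (x |: X :\ b) <= 2].
Proof.
have [s sIX sCs] := cocircuit_meets.
have [|[L1 [L2 [sL1 xsL2 LX r1 r2]]]] := two_lines sIX sCs; first by left.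
have [xL2 sL2] : x \in L2 /\ s \in L2 by move: xsL2; rewrite subUset !sub1set => /andP.
have rxX : 3 <= r (x |: X) by apply: leq_trans rX3 (rkS _ (subsetUr _ _)).
have sE := subsetP sX _ sIX.
have LE : x |: X \subset E by rewrite subUset sub1set xE.
have sL1X : L1 \subset x |: X by rewrite -LX subsetUl.
have sL2X : L2 \subset x |: X by rewrite -LX subsetUr.
have xs : x != s by apply: contraNneq xX => ->.
have [b bL] : exists b, b \in L1 :\: L2.
  apply/set0Pn; apply: contraTneq rxX => L0; rewrite -leqNgt -LX.
  by apply: leq_trans r2; apply: rkS; rewrite subUset subxx andbT -setD_eq0 L0.
have inX b' : b' \in L1 :\: L2 -> b' \in X /\ b' \in L1.
  rewrite inE => /andP[bL2 bL1]; split=> //.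
  by have := subsetP sL1X _ bL1; rewrite inE => /orP[/set1P bx|//];
    rewrite bx xL2 in bL2.
have [bX bL1] := inX b bL.
have bL2 : b \notin L2 by move: bL; rewrite inE => /andP[].
have [sub|/subsetPn[b' bL' bb']] := boolP (L1 :\: L2 \subset [set b]).
  right; exists b, s; split=> //; first by apply: contraNneq bL2 => <-.
  apply: leq_trans r2; apply: rkS; rewrite subUset sub1set xL2;
    apply/subsetP=> z /setD1P[zb zX].
  have : z \in L1 :|: L2 by rewrite LX inE zX orbT.
  case/setUP=> // zL1; apply: contraR zb => zL2.
  by have := subsetP sub z; rewrite !inE zL1 zL2 => /(_ isT).
have [bX' bL1'] := inX b' bL'.
(* The points b and b' of the line L1 cannot both avoid C*, so a second pair of lines can be drawn
   from one of them. *)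
have [s2 s2L s2C] : exists2 s2, s2 \in L1 :\: L2 & s2 \in Cs.
  have bb : b' != b by move: bb'; rewrite inE.
  have := line_meets_cocircuit r1 (subset_trans sL1X LE) sL1 sCs bL1' bL1 bb.
  by case/orP=> h; [exists b' | exists b].
have [s2X s2L1] := inX s2 s2L.
have s2L2 : s2 \notin L2 by move: s2L; rewrite inE => /andP[].
have [|[K1 [K2 [sK1 xsK2 KX k1 k2]]]] := two_lines s2X s2C; first by left.
have [xK2 sK2] : x \in K2 /\ s2 \in K2 by move: xsK2; rewrite subUset !sub1set => /andP.
exfalso.
(* A line through s2 and two points of L2 puts s2 in cl(L2). Then L1 and L2 span the same line, that
   of s and s2, and X + x has rank two. *)
have key u v (K : {set T}) : u \in L2 -> v \in L2 -> u != v -> u \in K -> v \in K ->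
    s2 \in K -> r K <= 2 -> False.
  move=> uL vL uv uK vK s2K rK.
  have suv : [set u; v] \subset L2 by rewrite subUset !sub1set uL.
  have ruv := rk_set2 M3 M4 (subsetP LE _ (subsetP sL2X _ uL)) (subsetP LE _
    (subsetP sL2X _ vL)) uv.
  have h : r (s2 |: [set u; v]) <= r [set u; v].
    by rewrite ruv; apply: leq_trans rK; apply: rkS; rewrite !subUset !sub1set s2K uK.
  have h2 := rk_cl_mono suv h.
  have ss2 : s != s2 by apply: contraNneq s2L2 => <-.
  have := rk_set2 M3 M4 sE (subsetP sX _ s2X) ss2.
  have sU : x |: X \subset L1 :|: (s2 |: L2) by rewrite -LX setUS ?subsetUr.
  have sI : [set s; s2] \subset L1 :&: (s2 |: L2).
    by rewrite subUset !sub1set !inE sL1 sL2 s2L1 eqxx orbT.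
  by have := rk_uncross M sU sI; rlia.
(* If L2 had no third point, L1 would contain X. The points x, s, a are shared out between K1 and
   K2, both of which pass through s2, so two of them fall on one of these lines. *)
have [a aL2 axs] : exists2 a, a \in L2 & a \notin [set x; s].
  apply/subsetPn; apply: contraTN rX3 => sub; rewrite -leqNgt; apply: leq_trans r1;
    apply: rkS.
  apply/subsetP=> z zX; have : z \in L1 :|: L2 by rewrite LX inE zX orbT.
  case/setUP=> // /(subsetP sub); rewrite !inE => /orP[] /eqP zE; last by rewrite zE.
  by have := xX; rewrite -zE zX.
move: axs; rewrite !inE negb_or => /andP[ax as_].
have inK z : z \in L2 -> z \notin K2 -> z \in K1.
  by move=> /(subsetP sL2X); rewrite -KX inE => /orP[] // ->.
have [sK2'|/(inK s sL2) sK1'] := boolP (s \in K2); first exact: (key x s K2).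
have [aK2|/(inK a aL2) aK1] := boolP (a \in K2); first by apply: (key a x K2).
exact: (key a s K1).
Qed.

Lemma conclusion_step : conclusion.
Proof.
have [|[b [s [bX sIX sb sCs rL]]]] := segment_in_X; first by [].
have LE : x |: X :\ b \subset E by rewrite subUset sub1set xE (subset_trans
  (subD1set _ _)).
have xL : x \in x |: X :\ b by exact: setU11.
(* Only when X has no fourth element may c lie outside C*; X is then the triad of (iii). *)
have [c [cX cb cs cC]] :
  exists c, [/\ c \in X, c != b, c != s & (c \in Cs) || (X \subset [set c; s; b])].
  have [a aX] : exists2 a, a \in X & a \notin [set s; b].
    apply/subsetPn; apply: contraTN rX3 => /rkS-/(_ M) le; rewrite -leqNgt.
    by apply: leq_trans le _; apply: leq_trans (rk_card _ _) _; rewrite cards2;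
      case: (s != b).
  rewrite !inE negb_or => /andP[as_ ab].
  have [sub|/subsetPn[a' aX']] := boolP (X \subset [set a; s; b]).
    by exists a; rewrite sub orbT.
  rewrite !inE !negb_or -andbA => /and3P[aa' as' ab'].
  have aL : a \in x |: X :\ b by rewrite !inE ab aX orbT.
  have aL' : a' \in x |: X :\ b by rewrite !inE ab' aX' orbT.
  have := line_meets_cocircuit rL LE xL xC aL' aL aa'.
  by case/orP=> h; [exists a' | exists a]; split=> //; rewrite h.
pose Z := X :\: [set c; s; b].
have sE := subsetP sX _ sIX; have cE := subsetP sX _ cX.
have xs : x != s by apply: contraNneq xX => ->.
have xc : x != c by apply: contraNneq xX => ->.
have xb : x != b by apply: contraNneq xX => ->.
have sc : s != c by rewrite eq_sym.
have sZ : Z \subset E by rewrite (subset_trans (subsetDl _ _)).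
have xZ : x \notin Z by rewrite inE (negPf xX) andbF.
have sZ' : s \notin Z by rewrite !inE eqxx orbT.
have cZ : c \notin Z by rewrite !inE eqxx.
have rLZ : r ([set x; s; c] :|: Z) <= 2.
  apply: leq_trans rL; apply: rkS;
    rewrite !subUset !sub1set !inE eqxx sb cb sIX cX !orbT /=.
  by apply/subsetP=> z; rewrite !inE !negb_or => /andP[/andP[_ ->] ->]; rewrite orbT.
have [Cc [Fc [fc [mc cCc _]]]] := contractible cX.
have [/existsP[P vP]|] := boolP [exists P, vertical M c P]; last first.
  rewrite negb_exists => /forallP nv.
  have con := si_contract_connected M3 M4 cE nv.
  have min := has_minor_si_contract cCc mc.
  have [cCs|ncCs] := boolP (c \in Cs); first by constructor 1; exists c.
  have XE : X = [set c; s; b].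
    by apply/eqP; rewrite eqEsubset !subUset !sub1set cX sIX bX !andbT;
      rewrite (negPf ncCs) in cC.
  (* X = {c, s, b} has rank three, so r(Y) = r(E) - 1; as no element of X is in cl(Y), X is a
     cocircuit. *)
  constructor 3; exists x, c, s, b; split; last split=> //.
  - by rewrite !subUset !sub1set xE cE sE (subsetP sX).
  - apply: triangle_circuit => //; first by rewrite !subUset !sub1set xE cE sE.
    by apply: leq_trans rLZ; apply: rkS; rewrite !subUset !sub1set !inE !eqxx !orbT.
  - rewrite -XE; apply/cocircuitP.
    have EX : E :\: X = x |: Y by rewrite /Y; setb.
    rewrite EX; have := indep cX => ic.
    have rX : r X <= 3.
      by rewrite XE; apply: leq_trans (rk_card _ _) _; rewrite !cardsU !cards1; rlia.
    have conX : r E + 2 <= r X + r Y.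
      have := @connected_rk2 _ M X (x |: Y) M3 sX.
      have -> : E \subset X :|: (x |: Y) by rewrite -EX; setb.
      have -> : 1 < #|X| by have := rk_card M X; rlia.
      have -> : 1 < #|E :\: X|.
        by rewrite EX; have := rk_card M Y;
          have := subset_leq_card (subsetUr [set x] Y); rlia.
      by move=> /(_ isT isT isT); rlia.
    split=> [//||e eX]; first by rlia.
    have m1 : e |: Y \subset e |: (x |: Y) by exact: setUS (subsetUr _ _).
    by have := rkS M m1; have := indep eX; rlia.
(* Here c has a vertical 3-partition. It survives the deletion of [Z], so [bixby] applies at c after
   that deletion. *)
constructor 2; exists s; split=> //; last first.
  have [C [F [f [mF sC _]]]] := contractible sIX.
  by apply: has_minor_co => //; exact: has_minor_si_contract mF.
have M'3 : connected 3 (delete M Z) by apply: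
  (@delete_segment_connected _ M M3 M4 x s c Z).
have M'4 : 4 <= #|ground (delete M Z)|.
  have xY : x \notin Y by rewrite !inE eqxx.
  have sub : x |: Y \subset ground (delete M Z).
    rewrite subUset sub1set in_setD xZ xE /=; apply: setDS.
    exact: subset_trans (subsetDl _ _) (subsetUr _ _).
  apply: leq_trans (subset_leq_card sub); rewrite cardsU1 xY.
  by have := rk_card M Y; rlia.
have [P' vP'] : exists P', vertical (delete M Z) c P'.
  by apply: (@vertical_delete_segment _ M M3 M4 x s c Z) vP.
have F0E : E :\: (c |: Z) = ground (delete M Z) :\ c by rewrite /= setDDl setUC.
have WE : E :\: (c |: Z) :\ s :\ b = x |: Y by rewrite /Y /Z; setb.
apply: (@co_si_connected _ M M3 M4 x s c Z xE sE xs sc xc xZ sZ' rLZ b).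
- by rewrite !inE (subsetP sX) // !eqxx !orbT /= eq_sym (negPf cb).
- by rewrite eq_sym.
(* Since s is outside cl(Y), which contains x, it becomes a coloop once c, [Z] and b are removed. *)
- rewrite WE; have := indep sIX.
  have m1 : s |: Y \subset s |: (x |: Y) by exact: setUS (subsetUr _ _).
  by have := rkS M m1; rlia.
move=> A; rewrite F0E => sA cA cB; have := bixby M'3 M'4 vP' sA cA cB.
rewrite !rk_delete.
(* The points x and s remain and span [Z], so the rank does not drop and the bound obtained after
   deleting [Z] is valid in M. *)
have rE : r E <= r (E :\: Z).
  apply: leq_trans (_ : r (([set x; s; c] :|: Z) :|: (E :\: Z)) <= _).
    by apply: rkS; rewrite -{1}(setID E Z) setSU // subIset // subsetUr orbT.
  apply: (segment_span M3 M4 xE sE cE sZ rLZ (p := x) (q := s)) => //.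
  - by rewrite !inE eqxx.
  - by rewrite !inE eqxx orbT.
  - by rewrite inE xZ.
  - by rewrite inE sZ'.
have DD (B : {set T}) : r (B :\: Z) <= r B by apply/rkS/subsetDl.
have := DD A; have := DD (ground (delete M Z) :\ c :\: A).
have -> : ground (delete M Z) :\: Z = E :\: Z by rewrite /= setDDl setUid.
rlia.
Qed.

End Step.
(** Strong induction on |X| replaces the minimal choice. The minor is quantified together with x and
    X because a descent may contract a different element. An element of X in cl(Y) gives a descent
    that keeps both x and the minor. *)
Lemma conclusion_vertical x X (C F : {set T}) (f : T -> T') : vertical M x X ->
  x \in Cs ->
  minor_map M N C F f -> x \in C -> #|F :&: X| <= 1 -> conclusion.
Proof.
have [n] := ubnP #|X|; elim: n x X C F f => // n IH x X C F f.
rewrite ltnS => cX vX xCs mF xC FX.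
have IHX x' X' (C' F' : {set T}) (f' : T -> T') : #|X'| < #|X| ->
  vertical M x' X' -> x' \in Cs ->
    minor_map M N C' F' f' -> x' \in C' -> #|F' :&: X'| <= 1 -> conclusion.
  by move=> lt; apply: IH; exact: leq_trans lt cX.
have [/exists_inP[e eX le]|] :=
    boolP [exists e in X, r (e |: E :\: (x |: X)) <= r (E :\: (x |: X))].
  have lt : #|X :\ e| < #|X| by rewrite (cardsD1 e X) eX.
  apply: (IHX _ _ _ _ _ lt (vertical_move M3 M4 vX eX le) xCs mF xC).
  by apply: leq_trans FX; apply/subset_leq_card/setIS/subD1set.
move=> /exists_inPn indep; apply: (conclusion_step vX xCs IHX _ mF xC FX).
by move=> e eX; rewrite ltnNge; exact: indep.
Qed.

(** Without a vertical 3-partition at x, (i) holds for x itself. With one, [minor_map_sides] leaves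
    at most one element of the minor on some side, and the two sides are interchangeable. *)
Lemma conclusion_contract x : x \in Cs -> has_minor (contract M [set x]) N ->
  conclusion.
Proof.
move=> xCs hm; have [sCs _ _] := cocircuitP _ _ cocCs; have xE := subsetP sCs _ xCs.
have [|C [F [f /(minor_map_contract xE) mF]]] := has_minor_map _ hm; first by rlia.
have xC : x \in x |: C by exact: setU11.
have [/existsP[X vX]|] := boolP [exists X, vertical M x X]; last first.
  rewrite negb_exists => /forallP nv; constructor 1; exists x; split=> //.
    exact: si_contract_connected.
  exact: has_minor_si_contract mF.
have [[_ sX xX] clX clY h _] := verticalP _ _ _ vX; set Y := E :\: (x |: X) in clY h.
have := minor_map_sides N3 mF N4 (A := x |: X) (B := x |: Y) (s := x) xC.
have -> : E \subset x |: X :|: (x |: Y) by rewrite /Y; setb.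
have -> : (x |: X) :&: (x |: Y) \subset [set x] by rewrite /Y; setb.
rewrite !setU11 (rk_set1 M3 M4 xE) => /(_ isT isT isT isT).
have -> : r (x |: X) + r (x |: Y) <= r E + 1 + 1 by rlia.
have [_ sF dCF _ _] := mF.
case/(_ isT)/orP=> cF; [apply: (conclusion_vertical vX xCs mF xC)|
  apply: (conclusion_vertical (vertical_sym vX) xCs mF xC)].
  by apply: leq_trans cF; apply/subset_leq_card/setIS/subsetUr.
by apply: leq_trans cF; apply/subset_leq_card/subsetP=> z;
  rewrite !inE => /and3P[-> -> _].
Qed.

End Main.

Theorem theorem1p1 (T T' : finType) (M : matroid T) (N : matroid T')
    (Cs : {set T})
    (M3 : connected 3 M) (N3 : connected 3 N) (N4 : 4 <= #|ground N|)
    (cocCs : cocircuit M Cs)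
    (Cs_minor : exists x0 : T,
       x0 \in Cs /\ has_minor (contract M [set x0]) N) :
  [\/ exists x : T,
        [/\ x \in Cs, connected 3 (si (contract M [set x]))
          & has_minor (si (contract M [set x])) N],
      exists x : T,
        [/\ x \in Cs, connected 3 (co (si (contract M [set x])))
          & has_minor (co (si (contract M [set x]))) N]
    | exists x1 x2 x3 x4 : T,
        [set x1; x2; x3; x4] \subset ground M /\
        [/\ circuit M [set x1; x2; x3],
            cocircuit M [set x2; x3; x4],
            x1 \in Cs /\ x3 \in Cs,
            connected 3 (si (contract M [set x2]))
          & has_minor (si (contract M [set x2])) N]].
Proof.
have [x0 [x0C hm]] := Cs_minor; apply: (conclusion_contract M3 N3 N4 _ cocCs x0C hm).
have [|C [F [f mF]]] := has_minor_map _ hm; first exact: leq_trans N4.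
have [_ sF _ _ _] := mF; rewrite -(minor_map_card mF) in N4.
apply: leq_trans N4 _; apply: subset_leq_card; apply: subset_trans sF _.
exact: subsetDl.
Qed.
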